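(* Let $R$ be a commutative Noetherian ring of finite Krull dimension, $\mathfrak{a}$ an ideal of $R$, and $X,Y\in\mathcal{D}^f_+(R)$. Then $$\mathrm{cd}(\mathfrak{a},X\otimes^{\mathbf{L}}_R Y)\le \mathrm{cd}(\mathfrak{a},X)-\inf Y.$$
   Context: Complexes are graded homologically (differentials $X_\ell\to X_{\ell-1}$). $\mathcal{D}(R)$ is the derived category of $R$-modules; $\mathcal{D}^f_+(R)$ is the full subcategory of complexes $X$ with $H_\ell(X)=0$ for $\ell\ll 0$ and every $H_\ell(X)$ finitely generated. $-\otimes^{\mathbf{L}}_R-$ is the derived tensor product. $\inf Y=\inf\{\ell\mid H_\ell(Y)\ne0\}$, which is $\infty$ if $H(Y)=0$. For an $R$-module $M$, $\mathrm{cd}(\mathfrak{a},M)=\sup\{i\in\mathbb{Z}\mid H^i_{\mathfrak{a}}(M)\neq0\}$, where $H^i_{\mathfrak a}$ denotes local cohomology. For a complex $X$, $\mathrm{cd}(\mathfrak{a},X)=\sup\{\mathrm{cd}(\mathfrak{a},H_\ell(X))-\ell\mid \ell\in\mathbb{Z}\}$. All sups and infs are taken in $\mathbb{Z}\cup\{\pm\infty\}$, with $\sup\emptyset=-\infty$. *)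

(* Defs.v *)
From HB Require Import structures.
From mathcomp Require Import all_boot all_order all_algebra.
From mathcomp Require Import boolp classical_sets functions cardinality fsbigop.
From mathcomp Require Import constructive_ereal.

Set Implicit Arguments.
Unset Strict Implicit.
Unset Printing Implicit Defensive.

Import Order.TTheory GRing.Theory Num.Theory.
Local Open Scope ring_scope.
Local Open Scope classical_set_scope.
Local Open Scope quotient_scope.

Record submodule (R : pzRingType) (V : lmodType R) := Submodule {
  submodule_pred :> {pred V};
  submoduleP : submod_closed submodule_pred }.

Section Submodules.
Variables (R : pzRingType) (V : lmodType R).

HB.instance Definition _ (N : submodule V) :=
  GRing.isSubmodClosed.Build R V (submodule_pred N) (submoduleP N).

Definition subm (N : submodule V) : Type := {x : V | x \in (N : {pred V})}.
HB.instance Definition _ (N : submodule V) := SubType.on (subm N).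
HB.instance Definition _ (N : submodule V) := [Choice of subm N by <:].
HB.instance Definition _ (N : submodule V) :=
  [SubChoice_isSubLmodule of subm N by <:].

Definition quotm (N : submodule V) : Type :=
  Quotient.quot (GRing.ZmodClosed.clone V (N : {pred V}) _).
HB.instance Definition _ (N : submodule V) := GRing.Zmodule.on (quotm N).
HB.instance Definition _ (N : submodule V) := Quotient.on (quotm N).

Definition span_pred (S : set V) : {pred V} :=
  [pred x | `[< forall N : submodule V, (forall y, S y -> y \in N) -> x \in N >]].

Fact span_closed (S : set V) : submod_closed (span_pred S).
Proof.
split=> [|k x y /asboolP Sx /asboolP Sy]; apply/asboolP => N SN.
  exact: rpred0.
by apply: rpredD; [apply: rpredZ; exact: Sx|exact: Sy].
Qed.

Definition span (S : set V) : submodule V := Submodule (span_closed S).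

Lemma mem_span (S : set V) x : S x -> x \in span S.
Proof. by move=> Sx; apply/asboolP => N; exact. Qed.

Lemma span_sub (S : set V) (N : submodule V) :
  (forall y, S y -> y \in N) -> forall x, x \in span S -> x \in N.
Proof. by move=> SN x /asboolP; exact. Qed.

End Submodules.

Section QuotientModule.
Variables (R : pzRingType) (V : lmodType R) (N : submodule V).
Implicit Types (x y : quotm N) (u v : V).

Definition quotm_pi u : quotm N := \pi u.

Lemma quotm_pi_eq u v : quotm_pi u = quotm_pi v <-> u - v \in N.
Proof.
rewrite /quotm_pi; split=> [/eqP|uv]; first by rewrite -Quotient.idealrBE.
by apply/eqP; rewrite -Quotient.idealrBE.
Qed.

Lemma quotm_piD u v : quotm_pi (u + v) = quotm_pi u + quotm_pi v.
Proof. exact: Quotient.pi_add. Qed.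

Lemma quotm_reprK x : quotm_pi (repr x) = x.
Proof. exact: reprK. Qed.

Definition quotm_scale (a : R) x : quotm N := quotm_pi (a *: repr x).

Lemma quotm_scale_pi a u : quotm_scale a (quotm_pi u) = quotm_pi (a *: u).
Proof.
apply/quotm_pi_eq; rewrite -scalerBr; apply: rpredZ; apply/quotm_pi_eq.
exact: quotm_reprK.
Qed.

Fact quotm_scaleA a b x : quotm_scale a (quotm_scale b x) = quotm_scale (a * b) x.
Proof. by rewrite -(quotm_reprK x) !quotm_scale_pi scalerA. Qed.
Fact quotm_scale1 : left_id 1 quotm_scale.
Proof. by move=> x; rewrite -(quotm_reprK x) quotm_scale_pi scale1r. Qed.
Fact quotm_scaleDr : right_distributive quotm_scale +%R.
Proof.
move=> a x y; rewrite -(quotm_reprK x) -(quotm_reprK y) -quotm_piD.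
by rewrite !quotm_scale_pi -quotm_piD scalerDr.
Qed.
Fact quotm_scaleDl x : {morph quotm_scale^~ x : a b / a + b}.
Proof.
move=> a b; rewrite -(quotm_reprK x) !quotm_scale_pi -quotm_piD.
by rewrite scalerDl.
Qed.
HB.instance Definition _ := GRing.Zmodule_isLmodule.Build R (quotm N)
  quotm_scaleA quotm_scale1 quotm_scaleDr quotm_scaleDl.

Fact quotm_pi_linear : linear quotm_pi.
Proof. by move=> a u v; rewrite quotm_piD -quotm_scale_pi. Qed.
HB.instance Definition _ :=
  GRing.isLinear.Build R V (quotm N) _ quotm_pi quotm_pi_linear.

End QuotientModule.
Arguments quotm_pi {R V} N u.

Section InducedMaps.
Variables (R : pzRingType) (V W : lmodType R) (h : {linear V -> W}).

Section Lift.
Variables (N : submodule V) (hN : forall x, x \in N -> h x = 0).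
Definition quotm_lift of (forall x, x \in N -> h x = 0) :=
  fun x : quotm N => h (repr x).
Local Notation f := (quotm_lift hN).
Lemma quotm_lift_pi u : f (quotm_pi N u) = h u.
Proof.
apply/eqP; rewrite -subr_eq0 -raddfB; apply/eqP/hN/quotm_pi_eq.
exact: quotm_reprK.
Qed.
Fact quotm_lift_linear : linear f.
Proof.
move=> a x y; rewrite -(quotm_reprK x) -(quotm_reprK y) -linearP.
by rewrite !quotm_lift_pi linearP.
Qed.
HB.instance Definition _ :=
  GRing.isLinear.Build R (quotm N) W _ f quotm_lift_linear.
End Lift.

Section Restrict.
Variables (N : submodule V) (N' : submodule W).
Variable hN : forall x, x \in N -> h x \in N'.
Definition subm_map :=
  fun x : subm N => (exist _ (h (val x)) (hN (valP x)) : subm N').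
Local Notation f := subm_map.
Fact subm_map_linear : linear f.
Proof. by move=> a x y; apply: val_inj; rewrite /= linearP. Qed.
HB.instance Definition _ :=
  GRing.isLinear.Build R (subm N) (subm N') _ f subm_map_linear.
End Restrict.
End InducedMaps.

Section DirectSum.
Variables (R : pzRingType) (I : choiceType) (M : I -> lmodType R).

Record dsum := Dsum {
  dsum_fun :> forall i, M i;
  dsum_finite : finite_set [set i | dsum_fun i <> 0] }.
HB.instance Definition _ := gen_eqMixin dsum.
HB.instance Definition _ := gen_choiceMixin dsum.
Implicit Types f g h : dsum.

Lemma dsumP f g : (forall i, f i = g i) -> f = g.
Proof.
case: f g => [f Ff] [g Fg] /= fg0; have fg := functional_extensionality_dep fg0.
by clear fg0; move: Ff Fg; rewrite fg => Ff Fg; rewrite (Prop_irrelevance Ff Fg).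
Qed.

Fact dsum_zero_finite : finite_set [set i | (0 : M i) <> 0].
Proof. by apply: (sub_finite_set _ (finite_set0 I)) => i /=. Qed.
Definition dsum_zero := Dsum dsum_zero_finite.

Fact dsum_opp_finite f : finite_set [set i | - f i <> 0].
Proof.
apply: sub_finite_set (dsum_finite f) => i /= nf0 f0.
by apply: nf0; rewrite f0 oppr0.
Qed.
Definition dsum_opp f := Dsum (dsum_opp_finite f).

Fact dsum_add_finite f g : finite_set [set i | f i + g i <> 0].
Proof.
have /sub_finite_set : [set i | f i + g i <> 0] `<=`
    [set i | f i <> 0] `|` [set i | g i <> 0].
  move=> i /= nfg; apply: contrapT => /not_orP[/contrapT fi /contrapT gi].
  by apply: nfg; rewrite fi gi addr0.
by apply; rewrite finite_setU; split; exact: dsum_finite.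
Qed.
Definition dsum_add f g := Dsum (dsum_add_finite f g).

Fact dsum_scale_finite (a : R) f : finite_set [set i | a *: f i <> 0].
Proof.
apply: sub_finite_set (dsum_finite f) => i /= naf f0.
by apply: naf; rewrite f0 scaler0.
Qed.
Definition dsum_scale a f := Dsum (dsum_scale_finite a f).

Fact dsum_addA : associative dsum_add.
Proof. by move=> f g h; apply: dsumP => i /=; rewrite addrA. Qed.
Fact dsum_addC : commutative dsum_add.
Proof. by move=> f g; apply: dsumP => i /=; rewrite addrC. Qed.
Fact dsum_add0 : left_id dsum_zero dsum_add.
Proof. by move=> f; apply: dsumP => i /=; rewrite add0r. Qed.
Fact dsum_addN : left_inverse dsum_zero dsum_opp dsum_add.
Proof. by move=> f; apply: dsumP => i /=; rewrite addNr. Qed.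
HB.instance Definition _ :=
  GRing.isZmodule.Build dsum dsum_addA dsum_addC dsum_add0 dsum_addN.

Fact dsum_scaleA a b f : dsum_scale a (dsum_scale b f) = dsum_scale (a * b) f.
Proof. by apply: dsumP => i /=; rewrite scalerA. Qed.
Fact dsum_scale1 : left_id 1 dsum_scale.
Proof. by move=> f; apply: dsumP => i /=; rewrite scale1r. Qed.
Fact dsum_scaleDr : right_distributive dsum_scale +%R.
Proof. by move=> a f g; apply: dsumP => i /=; rewrite scalerDr. Qed.
Fact dsum_scaleDl f : {morph dsum_scale^~ f : a b / a + b}.
Proof. by move=> a b; apply: dsumP => i /=; rewrite scalerDl. Qed.
HB.instance Definition _ := GRing.Zmodule_isLmodule.Build R dsum
  dsum_scaleA dsum_scale1 dsum_scaleDr dsum_scaleDl.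

End DirectSum.

Section FreeModule.
Variables (R : pzRingType) (T : choiceType).

Definition free : lmodType R := dsum (fun _ : T => R^o).

Fact delta_finite (t : T) : finite_set [set s | ((s == t)%:R : R^o) <> 0].
Proof.
apply: (sub_finite_set _ (finite_set1 t)) => s /=.
by case: eqP => [->//|_ /(_ erefl)].
Qed.
Definition delta (t : T) : free := Dsum (delta_finite t).

Variables (V : lmodType R) (phi : T -> V).

Definition free_lift (f : free) : V := \sum_(t \in [set: T]) (f t : R) *: phi t.

Lemma free_lift_widen (f : free) (A : set T) : finite_set A ->
  [set t | f t <> 0] `<=` A ->
  free_lift f = \sum_(t \in A) (f t : R) *: phi t.
Proof.
move=> finA fA; rewrite /free_lift; apply/esym/fsbig_widen => //.
move=> t /= [_ /(contra_not (fA t)) /contrapT ft0].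
by rewrite ft0 scale0r.
Qed.

Fact free_lift_linear : linear free_lift.
Proof.
move=> a f g.
pose A := [set t | f t <> 0] `|` [set t | g t <> 0].
have finA : finite_set A by rewrite finite_setU; split; exact: dsum_finite.
rewrite !(@free_lift_widen _ A) //; first last.
- move=> t /= nfg; apply: contrapT => /not_orP[/contrapT fi /contrapT gi].
  by apply: nfg; rewrite /= fi gi scaler0 addr0.
- by move=> t; left.
- by move=> t; right.
rewrite !fsbig_finite //= scaler_sumr -big_split /=; apply: eq_bigr => t _.
by rewrite scalerDl scalerA.
Qed.
HB.instance Definition _ :=
  GRing.isLinear.Build R free V _ free_lift free_lift_linear.

Lemma free_lift_delta t : free_lift (delta t) = phi t.
Proof.
rewrite (@free_lift_widen _ [set t]) //; last first.
  by move=> s /=; case: eqP => [->//|_ /(_ erefl)].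
by rewrite fsbig_set1 /= eqxx scale1r.
Qed.

End FreeModule.

Lemma free_ext (R : pzRingType) (T : choiceType) (V : lmodType R)
    (h k : {linear free R T -> V}) :
  (forall t, h (delta R t) = k (delta R t)) -> h =1 k.
Proof.
move=> hk f.
have /finite_seqP[r0 fr0] : finite_set [set t | f t <> 0] := dsum_finite f.
pose r := undup r0.
have fr t : f t <> 0 -> t \in r.
  by move=> ft; rewrite mem_undup; move: ft; rewrite -[_ <> _]/([set t | f t <> 0] t) fr0.
have -> : f = \sum_(t <- r) (f t : R) *: delta R t.
  apply: dsumP => s.
  rewrite (big_morph (fun g : free R T => (g s : R)) (id1 := 0) (op1 := +%R)) //=.
  have [fs0|/eqP fs0] := eqVneq (f s) 0.
    rewrite fs0 big1 // => t _.
    by case: eqP => [<-|_]; [rewrite fs0; exact: mul0r|exact: mulr0].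
  rewrite (bigD1_seq s) ?fr ?undup_uniq //= eqxx big1 => [|t /negPf ts].
    by rewrite [RHS]addr0 [RHS]mulr1.
  by rewrite eq_sym ts; exact: mulr0.
by rewrite !linear_sum; apply: eq_bigr => t _; rewrite !linearZ hk.
Qed.

Section Tensor.
Variables (R : comPzRingType) (M N : lmodType R).

Let F := free R (M * N)%type.
Let e (x : M) (y : N) : F := delta R (x, y).

Definition bilinear_relations : set F :=
  [set r | exists x x' y, r = e (x + x') y - e x y - e x' y] `|`
  [set r | exists x y y', r = e x (y + y') - e x y - e x y'] `|`
  [set r | exists (a : R) x y, r = e (a *: x) y - a *: e x y] `|`
  [set r | exists (a : R) x y, r = e x (a *: y) - a *: e x y].

Definition tensor : lmodType R := quotm (span bilinear_relations).

Definition tens (x : M) (y : N) : tensor := quotm_pi _ (e x y).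

Lemma tensDl x x' y : tens (x + x') y = tens x y + tens x' y.
Proof.
rewrite -linearD; apply/quotm_pi_eq/mem_span; left; left; left.
by exists x, x', y; rewrite opprD addrA.
Qed.
Lemma tensDr x y y' : tens x (y + y') = tens x y + tens x y'.
Proof.
rewrite -linearD; apply/quotm_pi_eq/mem_span; left; left; right.
by exists x, y, y'; rewrite opprD addrA.
Qed.
Lemma tensZl a x y : tens (a *: x) y = a *: tens x y.
Proof.
rewrite -linearZ; apply/quotm_pi_eq/mem_span; left; right.
by exists a, x, y.
Qed.
Lemma tensZr a x y : tens x (a *: y) = a *: tens x y.
Proof. by rewrite -linearZ; apply/quotm_pi_eq/mem_span; right; exists a, x, y. Qed.

Lemma tensor_ext (V : lmodType R) (h k : {linear tensor -> V}) :
  (forall x y, h (tens x y) = k (tens x y)) -> h =1 k.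
Proof.
move=> hk t; rewrite -(quotm_reprK t).
apply: (@free_ext _ _ _ (h \o quotm_pi _) (k \o quotm_pi _)) => -[x y].
exact: hk.
Qed.
End Tensor.
Arguments tens {R M N} x y.

Section Kernel.
Variables (R : pzRingType) (V W : lmodType R) (k : {linear V -> W}).
Fact kerm_closed :
  submod_closed [pred x | k x == 0].
Proof.
split=> [|a x y]; rewrite !inE ?linear0// => /eqP kx /eqP ky.
by rewrite linearP kx ky scaler0 addr0.
Qed.
Definition kerm : submodule V :=
  Submodule kerm_closed.
Lemma kermP x : reflect (k x = 0) (x \in kerm).
Proof. exact: eqP. Qed.
End Kernel.

Section TensorMap.
Variables (R : comPzRingType) (M N M' N' : lmodType R).
Variables (f : {linear M -> M'}) (g : {linear N -> N'}).

Local Notation h := (free_lift (fun p : M * N => tens (f p.1) (g p.2))).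

Fact tensor_map_rel x : x \in span (@bilinear_relations R M N) -> h x = 0.
Proof.
move=> xN; apply/kermP.
apply: span_sub xN => r rel; apply/kermP.
case: rel => [[[]|]|] [u [v [w ->]]].
- rewrite !linearB /= !free_lift_delta /= linearD tensDl -addrA -opprD.
  exact: subrr.
- rewrite !linearB /= !free_lift_delta /= linearD tensDr -addrA -opprD.
  exact: subrr.
- by rewrite linearB linearZ /= !free_lift_delta /= linearZ tensZl; exact: subrr.
- by rewrite linearB linearZ /= !free_lift_delta /= linearZ tensZr; exact: subrr.
Qed.

Definition tensor_map : tensor M N -> tensor M' N' := quotm_lift tensor_map_rel.
HB.instance Definition _ := GRing.Linear.on tensor_map.

Lemma tensor_map_tens x y : tensor_map (tens x y) = tens (f x) (g y).
Proof. by rewrite [LHS]quotm_lift_pi /= free_lift_delta. Qed.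
End TensorMap.

(* Homological grading: diff i j is the differential when i = j + 1 and 0
   otherwise; indexing it by all pairs (i, j) avoids casts between degrees. *)
Record complex (R : pzRingType) := Complex {
  cobj :> int -> lmodType R;
  diff : forall i j, {linear cobj i -> cobj j};
  diff_shape : forall i j x, i != j + 1 -> diff i j x = 0;
  diff_diff : forall i j k x, diff j k (diff i j x) = 0 }.
Arguments diff {R} c i j.

Record cmap (R : pzRingType) (X Y : complex R) := Cmap {
  cmap_fun :> forall i, {linear X i -> Y i};
  cmap_diff : forall i j x, diff Y i j (cmap_fun i x) = cmap_fun j (diff X i j x) }.

Section Homology.
Variables (R : comPzRingType).
Implicit Types (X Y : complex R) (l : int).

Definition cycles X l : submodule (X l) := kerm (diff X l (l - 1)).

Definition boundaries_pred X l : {pred (subm (cycles X l))} :=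
  [pred z | `[< exists x : X (l + 1), diff X (l + 1) l x = val z >]].
Fact boundaries_closed X l : submod_closed (@boundaries_pred X l).
Proof.
split=> [|a y z /asboolP[u yu] /asboolP[v zv]]; apply/asboolP.
  by exists 0; rewrite linear0.
by exists (a *: u + v); rewrite linearP yu zv.
Qed.
Definition boundaries X l : submodule (subm (cycles X l)) :=
  Submodule (@boundaries_closed X l).

Definition homology X l : lmodType R := quotm (boundaries X l).

Section HomologyMap.
Variables (X Y : complex R) (f : cmap X Y) (l : int).
Fact cycles_map_mem x : x \in cycles X l -> f l x \in cycles Y l.
Proof. by move=> /kermP dx; apply/kermP; rewrite cmap_diff dx linear0. Qed.
Let h := quotm_pi (boundaries Y l) \o subm_map cycles_map_mem.
Fact homology_map_mem z : z \in boundaries X l -> h z = 0.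
Proof.
move=> /asboolP[x xz]; rewrite -(linear0 (quotm_pi (boundaries Y l))).
apply/quotm_pi_eq; rewrite subr0; apply/asboolP; exists (f (l + 1) x).
by rewrite cmap_diff xz.
Qed.
Definition homology_map : homology X l -> homology Y l :=
  quotm_lift homology_map_mem.
HB.instance Definition _ := GRing.Linear.on homology_map.
End HomologyMap.
Arguments homology_map {X Y} f l _.

Definition quasi_iso X Y (f : cmap X Y) := forall l, bijective (homology_map f l).

(* Isomorphism in the derived category: a roof of quasi-isomorphisms. *)
Definition derived_iso X Y :=
  exists Z (f : cmap Z X) (g : cmap Z Y), quasi_iso f /\ quasi_iso g.
End Homology.

Section TensorMapTheory.
Variables (R : comPzRingType) (M N M' N' M'' N'' : lmodType R).

Lemma tensor_map_comp (f : {linear M -> M'}) (g : {linear N -> N'})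
    (f' : {linear M' -> M''}) (g' : {linear N' -> N''}) t :
  tensor_map f' g' (tensor_map f g t) = tensor_map (f' \o f) (g' \o g) t.
Proof.
apply: (@tensor_ext _ _ _ _ (tensor_map f' g' \o tensor_map f g)) => x y.
by rewrite /= !tensor_map_tens.
Qed.

Lemma tensor_map_0l (f : {linear M -> M'}) (g : {linear N -> N'}) t :
  (forall x, f x = 0) -> tensor_map f g t = 0.
Proof.
move=> f0; apply: (@tensor_ext _ _ _ _ (tensor_map f g) \0) => x y.
by rewrite /= tensor_map_tens f0 -(scale0r 0) tensZl scale0r.
Qed.

Lemma tensor_map_0r (f : {linear M -> M'}) (g : {linear N -> N'}) t :
  (forall y, g y = 0) -> tensor_map f g t = 0.
Proof.
move=> g0; apply: (@tensor_ext _ _ _ _ (tensor_map f g) \0) => x y.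
by rewrite /= tensor_map_tens g0 -(scale0r 0) tensZr scale0r.
Qed.

Lemma tensor_map_eq (f f' : {linear M -> M'}) (g g' : {linear N -> N'}) t :
  f =1 f' -> g =1 g' -> tensor_map f g t = tensor_map f' g' t.
Proof.
move=> ff' gg'; apply: (@tensor_ext _ _ _ _ (tensor_map f g)) => x y.
by rewrite /= !tensor_map_tens ff' gg'.
Qed.
End TensorMapTheory.

Lemma sign_absz_succ (R : pzRingType) (a : int) :
  (-1) ^+ absz (a + 1) = - (-1) ^+ absz a :> R.
Proof.
case: a => n; first by rewrite -PoszD /= addn1 exprS mulN1r.
by rewrite NegzE -addn1 PoszD opprD subrK -opprD !abszN /= addn1 exprS mulN1r opprK.
Qed.

Section LinearComb.
Variables (R : comPzRingType) (A B C : lmodType R).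
Variables (h : {linear A -> C}) (k : {linear B -> C}) (s : R).

Fact linear_comb0 : h 0 + s *: k 0 = 0.
Proof. by rewrite !linear0 addr0. Qed.

Fact linear_combP a u v u' v' :
  h (a *: u + v) + s *: k (a *: u' + v') =
  a *: (h u + s *: k u') + (h v + s *: k v').
Proof. by rewrite !linearP !scalerDr !scalerA addrACA [a * _]mulrC. Qed.

Fact linear_comb u v : h (u + s *: v) = h u + s *: h v.
Proof. by rewrite linearD linearZ. Qed.
End LinearComb.

Section TensorComplex.
Variables (R : comPzRingType) (X Y : complex R).

Definition bidegree (n : int) : Type := {p : int * int | p.1 + p.2 == n}.
HB.instance Definition _ n := Choice.on (bidegree n).

Definition tensor_obj (n : int) : lmodType R :=
  dsum (fun p : bidegree n => tensor (X (val p).1) (Y (val p).2)).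

Section Differential.
Variables (n m : int) (nm : n = m + 1).
Implicit Types (q : bidegree m) (f : tensor_obj n).

Fact raise1_subproof q : ((val q).1 + 1, (val q).2).1 + ((val q).1 + 1, (val q).2).2 == n.
Proof. by rewrite /= addrAC (eqP (valP q)) nm. Qed.
Definition raise1 q : bidegree n := exist (fun p : int * int => p.1 + p.2 == n) _ (raise1_subproof q).

Fact raise2_subproof q : ((val q).1, (val q).2 + 1).1 + ((val q).1, (val q).2 + 1).2 == n.
Proof. by rewrite /= addrA (eqP (valP q)) nm. Qed.
Definition raise2 q : bidegree n := exist (fun p : int * int => p.1 + p.2 == n) _ (raise2_subproof q).

(* Component in bidegree q = (i, j) of d(x (x) y) = dx (x) y + (-1)^|x| x (x) dy:
   contributions from bidegrees (i + 1, j) and (i, j + 1). *)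
Definition tensor_diff_comp f q : tensor (X (val q).1) (Y (val q).2) :=
  tensor_map (diff X ((val q).1 + 1) (val q).1) idfun (f (raise1 q)) +
  (-1) ^+ `|(val q).1|%N *:
    tensor_map idfun (diff Y ((val q).2 + 1) (val q).2) (f (raise2 q)).

Fact tensor_diff_finite f : finite_set [set q | tensor_diff_comp f q <> 0].
Proof.
have finf := dsum_finite f.
apply: (@sub_finite_set _ _ (raise1 @^-1` [set p | f p <> 0] `|`
                             raise2 @^-1` [set p | f p <> 0])).
  move=> q /= nfq; apply: contrapT => /not_orP[/contrapT f1 /contrapT f2].
  by apply: nfq; rewrite /tensor_diff_comp f1 f2 linear_comb0.
rewrite finite_setU; split; apply: finite_preimage => //.
  move=> [[a b] ab] [[a' b'] ab'] _ _ /(congr1 val)[/addIr aa bb].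
  by apply: val_inj; rewrite /= aa bb.
move=> [[a b] ab] [[a' b'] ab'] _ _ /(congr1 val)[aa /addIr bb].
by apply: val_inj; rewrite /= aa bb.
Qed.

Definition tensor_diff_fun f : tensor_obj m := Dsum (tensor_diff_finite f).

Fact tensor_diff_linear : linear tensor_diff_fun.
Proof.
move=> a f g; apply: dsumP => q; exact: linear_combP.
Qed.
HB.instance Definition _ := GRing.isLinear.Build R (tensor_obj n)
  (tensor_obj m) _ tensor_diff_fun tensor_diff_linear.
End Differential.

Definition tensor_diff n m : {linear tensor_obj n -> tensor_obj m} :=
  if n =P m + 1 is ReflectT nm then tensor_diff_fun nm else \0.

Fact tensor_diff_shape n m x : n != m + 1 -> tensor_diff n m x = 0.
Proof. by rewrite /tensor_diff; case: eqP. Qed.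

Fact tensor_diff_diff n m k x : tensor_diff m k (tensor_diff n m x) = 0.
Proof.
rewrite /tensor_diff; case: eqP => [mk|_ //]; case: eqP => [nm|_]; last first.
  exact: linear0.
apply: dsumP => -[[a b] abk]; rewrite /= /tensor_diff_comp /= /tensor_diff_comp /=.
rewrite !linear_comb /= !tensor_map_comp /=.
rewrite tensor_map_0l ?add0r; last by move=> u /=; exact: diff_diff.
rewrite [X in _ + (_ + _ *: (_ *: X))]tensor_map_0r; last first.
  by move=> u /=; exact: diff_diff.
rewrite !scaler0 addr0 sign_absz_succ scaleNr; apply/eqP.
rewrite addrC subr_eq0; apply/eqP; congr (_ *: _).
set i1 := raise1 nm _; set i2 := raise2 nm _.
have xE (p q : (a + 1) + (b + 1) == n) :
    (x (exist _ (a + 1, b + 1) p) : tensor (X (a + 1)) (Y (b + 1))) =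
    x (exist _ (a + 1, b + 1) q) by rewrite (bool_irrelevance p q).
rewrite [LHS](@tensor_map_eq _ _ _ _ _ _ (diff X (a + 1) a \o idfun) _
  (idfun \o diff Y (b + 1) b)) //.
congr (tensor_map _ _ _); exact: xE.
Qed.

Definition tensor_complex : complex R :=
  Complex tensor_diff_shape tensor_diff_diff.
End TensorComplex.

Section Ideals.
Variable R : comPzRingType.

Definition ideal := submodule (R^o).
Implicit Types (a p : ideal).

Definition idealX a (n : nat) : ideal :=
  span [set \prod_(i < n) r i | r in [set r : 'I_n -> R^o | forall i, r i \in a]].

Lemma idealX_subl a m n (r : R^o) : r \in idealX a (m + n) -> r \in idealX a m.
Proof.
apply: span_sub => _ [s sa <-]; rewrite big_split_ord /= mulrC.
by apply: (@rpredZ R R^o (idealX a m)); apply: mem_span; exists (s \o lshift n) => // i; exact: sa.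
Qed.

Lemma idealX_subr a m n (r : R^o) : r \in idealX a (m + n) -> r \in idealX a n.
Proof. by rewrite addnC; exact: idealX_subl. Qed.

Definition fin_gen (M : lmodType R) :=
  exists s : seq M, forall x, x \in span [set` s].

Definition noetherian :=
  forall a, exists s : seq R^o, forall r, (r \in a) = (r \in span [set` s]).

Definition prime_ideal p :=
  (1 : R^o) \notin p /\
  forall r s : R, (r * s : R^o) \in p -> (r : R^o) \in p \/ (s : R^o) \in p.

Definition ideal_lt (p q : ideal) := [set` p] `<` [set` q].

(* Chains p 0 < ... < p n of primes have bounded length; only the first n + 1
   terms of the sequence p matter. *)
Definition finite_krull_dim :=
  exists d : nat, forall (n : nat) (p : nat -> ideal),
    (forall i, (i <= n)%N -> prime_ideal (p i)) ->
    (forall i, (i < n)%N -> ideal_lt (p i) (p i.+1)) -> (n <= d)%N.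

End Ideals.

Section Torsion.
Variables (R : comPzRingType) (a : ideal R).

Definition torsion_pred (M : lmodType R) : {pred M} :=
  [pred x | `[< exists n, forall r : R^o, r \in idealX a n -> (r : R) *: x = 0 >]].

Fact torsion_closed M : submod_closed (@torsion_pred M).
Proof.
split=> [|k x y /asboolP[m mx] /asboolP[n ny]]; apply/asboolP.
  by exists 0 => r _; exact: scaler0.
exists (m + n)%N => r rmn; rewrite scalerDr scalerA mulrC -scalerA.
by rewrite mx ?ny ?scaler0 ?addr0//; [exact: idealX_subr rmn|exact: idealX_subl rmn].
Qed.

Definition torsion M : submodule M := Submodule (@torsion_closed M).

Section TorsionComplex.
Variable X : complex R.

Definition torsion_obj i : lmodType R := subm (torsion (X i)).

Fact torsion_diff_mem i j (x : X i) :
  x \in torsion (X i) -> diff X i j x \in torsion (X j).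
Proof.
move=> /asboolP[n nx]; apply/asboolP; exists n => r rn.
by rewrite -linearZ nx// linear0.
Qed.
Definition torsion_diff i j : {linear torsion_obj i -> torsion_obj j} :=
  subm_map (@torsion_diff_mem i j).

Fact torsion_diff_shape i j x : i != j + 1 -> torsion_diff i j x = 0.
Proof. by move=> ij; apply: val_inj; rewrite /= diff_shape. Qed.
Fact torsion_diff_diff i j k x : torsion_diff j k (torsion_diff i j x) = 0.
Proof. by apply: val_inj; rewrite /= diff_diff. Qed.

Definition torsion_complex : complex R :=
  Complex torsion_diff_shape torsion_diff_diff.
End TorsionComplex.
End Torsion.

Section Resolutions.
Variable R : comPzRingType.

Definition zero_module (M : lmodType R) := forall x : M, x = 0.

Definition projective_module (P : lmodType R) :=
  forall (M N : lmodType R) (g : {linear M -> N}) (f : {linear P -> N}),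
    (forall y, exists x, g x = y) -> exists h : {linear P -> M}, g \o h =1 f.

Definition injective_module (E : lmodType R) :=
  forall (M N : lmodType R) (g : {linear M -> N}) (f : {linear M -> E}),
    injective g -> exists h : {linear N -> E}, h \o g =1 f.

Definition projective_resolution (X P : complex R) (f : cmap P X) :=
  [/\ exists n : int, forall l, l < n -> zero_module (P l),
      forall l, projective_module (P l)
    & quasi_iso f].

(* 0 -> M -> I^0 -> I^1 -> ... exact, with I^i in homological degree -i. *)
Definition injective_resolution (M : lmodType R) (I : complex R)
    (e : {linear M -> I 0}) :=
  [/\ forall l, injective_module (I l),
      forall l, 0 < l -> zero_module (I l),
      injective e,
      forall x, diff I 0 (-1) x = 0 <-> exists m, e m = x
    & forall l, l < 0 -> zero_module (homology I l)].

(* W is isomorphic in the derived category to the derived tensor product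
   of X and Y, for X with homology bounded below; such an X has a projective
   resolution, and any two choices give isomorphic P (x) Y. *)
Definition is_derived_tensor (X Y W : complex R) :=
  exists P (f : cmap P X),
    projective_resolution f /\ derived_iso (tensor_complex P Y) W.

Definition Df_plus (X : complex R) :=
  (exists n : int, forall l, l < n -> zero_module (homology X l)) /\
  forall l, fin_gen (homology X l).

End Resolutions.

Section CohomologicalDimension.
Variables (R : comPzRingType) (a : ideal R).
Local Open Scope ereal_scope.

(* H^i_a(M) <> 0, where H^i_a is the i-th right derived functor of the a-torsion
   functor; the choice of the injective resolution is irrelevant, as any two are
   homotopy equivalent. *)
Definition local_cohomology_neq0 (i : int) (M : lmodType R) :=
  exists (I : complex R) (e : {linear M -> I 0%R}),
    injective_resolution e /\
    ~ zero_module (homology (torsion_complex a I) (- i)).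

(* The order on \bar int is complete, so these are genuine suprema and infima,
   equal to -oo and +oo respectively on the empty set. *)
Definition cd (M : lmodType R) : \bar int :=
  supremum -oo [set i%:E | i in [set i : int | local_cohomology_neq0 i M]].

Definition cd_complex (X : complex R) : \bar int :=
  supremum -oo [set cd (homology X l) - l%:E | l in [set: int]].

Definition inf_complex (Y : complex R) : \bar int :=
  infimum +oo [set l%:E | l in [set l : int | ~ zero_module (homology Y l)]].

End CohomologicalDimension.

(* Main.v *)
From HB Require Import structures.
From mathcomp Require Import all_boot all_order all_algebra.
From mathcomp Require Import boolp classical_sets functions cardinality fsbigop.
From mathcomp Require Import constructive_ereal zify.
Require Import Defs.

Set Implicit Arguments.
Unset Strict Implicit.
Unset Printing Implicit Defensive.

Import Order.TTheory GRing.Theory Num.Theory.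
Local Open Scope ring_scope.
Local Open Scope classical_set_scope.

(** Fix a degree d and write t for the infimum of Y.  The inequality is the
    following implication, read through suprema: if H^j_a(H_l(X)) = 0 for all
    l <= d - t and all j >= i, then H^i_a(H_d(W)) = 0.  (If H(Y) = 0, any integer
    t will do, and a large one shows that H_d(W) = 0.)  It rests on an
    annihilation statement about the derived tensor product and a comparison
    statement about local cohomology.

    Annihilation ([tensor_homology_killed]).  Replace X by a bounded below
    complex P of projectives.  If r_l kills H_l(P) for every l <= d - t, the
    product r of these elements kills H_d(P (x) Y).  Indeed a cycle of degree d
    is homologous to one supported on the P_l (x) Y with l <= d - t, because
    P_l is flat and H_j(Y) = 0 for j < t ([cycle_truncate]); and on the part of
    P in degrees <= d - t multiplication by r is null-homotopic
    ([annihilator_homotopy]).  In terms of supports: the support of H_d(W) lies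
    in the union of the supports of the H_l(X) with l <= d - t.

    Comparison ([lc_vanish_ann]).  If M is finitely generated, ann M kills N and
    H^j_a(M) = 0 for all j >= i, then H^i_a(N) = 0.  This goes by descending
    induction on i, and starts because H^i_a = 0 as soon as i exceeds the number
    of generators of a ([lc_vanish_bound]).  Once the claim is known for i + 1,
    the modules with vanishing H^i_a that are killed by ann M are closed under
    extensions, direct sums and quotients; such a class contains every module
    killed by ann M as soon as it contains M, by noetherian induction on ideals
    ([torsion_class_ann]).  Filtering H_d(W) by the annihilators of the H_l(X)
    one at a time ([lc_vanish_prod]) combines the two statements.

    Vanishing of H^i_a is handled by a predicate [lc_vanish] defined by shifting
    dimension along 0 -> M -> E -> C -> 0 with E injective.  The long exact
    sequence is replaced by rotation: 0 -> K -> M -> L -> 0 yields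
    0 -> L -> E/K -> E/M -> 0, which lowers the cohomological degree by one
    ([lc_vanish_les]).  Every module embeds in an injective one
    ([enough_injectives]), hence has an injective resolution, and [lc_vanish]
    is the vanishing of the homology of the a-torsion of any such resolution
    ([lc_vanish_resolution]). *)

(** * Linear maps given by graphs *)
Section LinearOf.
Variables (R : comPzRingType) (V W : lmodType R).

Section Bundle.
Variables (f : V -> W) (lf : linear f).
Definition linear_fun_of of linear f := f.
HB.instance Definition _ :=
  GRing.isLinear.Build R V W _ (linear_fun_of lf) lf.
Definition linear_of : {linear V -> W} := linear_fun_of lf.
End Bundle.

(** Maps out of quotients, lifts through injections and extensions provided by
    Zorn's lemma are given by graphs rather than by formulas; this turns each of
    them into a linear map. *)
Lemma linear_of_graph (G : V -> W -> Prop) :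
  (forall a x y x' y', G x y -> G x' y' -> G (a *: x + x') (a *: y + y')) ->
  (forall x, exists y, G x y) -> (forall y, G 0 y -> y = 0) ->
  exists h : {linear V -> W}, forall x y, G x y <-> h x = y.
Proof.
move=> linG totG funG.
have funG' x y y' : G x y -> G x y' -> y = y'.
  move=> xy xy'; apply/eqP; rewrite -subr_eq0; apply/eqP/funG.
  have := linG (-1) _ _ _ _ xy' xy.
  by rewrite !scaleN1r addNr addrC.
have [h hG] := choice totG.
have lh : linear h.
  by move=> a x y; apply: funG' (hG _) _; apply: linG.
exists (linear_of lh) => x y; split=> [xy|<-]; last exact: hG.
exact: funG' (hG x) xy.
Qed.
End LinearOf.

(** * Short exact sequences *)
Section ShortExact.
Variable R : comPzRingType.

Definition short_exact (K M L : lmodType R)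
    (f : {linear K -> M}) (g : {linear M -> L}) :=
  [/\ injective f, (forall z, exists y, g y = z)
    & forall y, g y = 0 <-> exists x, f x = y].

Lemma inj_of_ker (V W : lmodType R) (f : {linear V -> W}) :
  (forall x, f x = 0 -> x = 0) -> injective f.
Proof.
move=> f0 x y fxy; apply/eqP; rewrite -subr_eq0; apply/eqP/f0.
by rewrite linearB fxy subrr.
Qed.

Lemma factor_surj (M L N : lmodType R) (g : {linear M -> L})
    (k : {linear M -> N}) :
  (forall z, exists y, g y = z) -> (forall y, g y = 0 -> k y = 0) ->
  exists h : {linear L -> N}, forall y, h (g y) = k y.
Proof.
move=> gs gk.
have [|z|z|h hP] := @linear_of_graph R L N
   (fun z w => exists2 y, g y = z & k y = w).
- move=> a _ _ _ _ [x <- <-] [y <- <-].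
  by exists (a *: x + y); rewrite linearP.
- by have [y yz] := gs z; exists (k y), y.
- by move=> [y y0 <-]; exact: gk.
by exists h => y; apply/hP; exists y.
Qed.

Lemma factor_inj (K M N : lmodType R) (f : {linear K -> M})
    (k : {linear N -> M}) :
  injective f -> (forall y, exists x, f x = k y) ->
  exists h : {linear N -> K}, forall y, f (h y) = k y.
Proof.
move=> fi kf.
have [||x|h hP] := @linear_of_graph R N K (fun y x => f x = k y).
- by move=> a x y x' y' e e'; rewrite !linearP e e'.
- by move=> y; have [x e] := kf y; exists x.
- by rewrite linear0 => e; apply: fi; rewrite e linear0.
by exists h => y; apply/hP.
Qed.

Lemma quotm_pi_surj (V : lmodType R) (N : submodule V) (z : quotm N) :
  exists y, quotm_pi N y = z.
Proof. by exists (generic_quotient.repr z); exact: quotm_reprK. Qed.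

Lemma quotm_pi0 (V : lmodType R) (N : submodule V) y :
  quotm_pi N y = 0 <-> y \in N.
Proof. by rewrite -(linear0 (quotm_pi N)) quotm_pi_eq subr0. Qed.

Definition in_subm (V : lmodType R) (N : submodule V) x (xN : x \in N) : subm N :=
  exist _ x xN.

Section Image.
Variables (V W : lmodType R) (f : {linear V -> W}).
Fact imm_closed : submod_closed [pred y | `[< exists x, f x = y >]].
Proof.
split=> [|a _ _ /asboolP[x <-] /asboolP[y <-]]; apply/asboolP.
  by exists 0; rewrite linear0.
by exists (a *: x + y); rewrite linearP.
Qed.
Definition imm : submodule W := Submodule imm_closed.
Lemma immP y : (y \in imm) <-> exists x, f x = y.
Proof. by split=> /asboolP. Qed.
End Image.

Lemma short_exact_coker (V W : lmodType R) (f : {linear V -> W}) :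
  injective f -> short_exact f (quotm_pi (imm f)).
Proof.
move=> fi; split=> // [z|y]; first exact: quotm_pi_surj.
by rewrite quotm_pi0 immP.
Qed.

Lemma short_exact_ker (V W : lmodType R) (g : {linear V -> W}) :
  (forall z, exists y, g y = z) ->
  short_exact (val : subm (kerm g) -> V) g.
Proof.
move=> gs; split; [exact: val_inj|exact: gs|move=> y].
split=> [y0|[x <-]]; last exact/kermP/(valP x).
by exists (in_subm (introT (kermP g y) y0)).
Qed.

Lemma short_exact_sub (V : lmodType R) (N : submodule V) :
  short_exact (val : subm N -> V) (quotm_pi N).
Proof.
split; [exact: val_inj|exact: quotm_pi_surj|move=> y].
rewrite quotm_pi0; split=> [yN|[x <-]]; last exact: (valP x).
by exists (in_subm yN).
Qed.
End ShortExact.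

(** * Injective modules *)
Section Baer.
Variables (R : comPzRingType) (E : lmodType R).

(** A graph [G] in [R * E] is a linear map from an ideal to [E]; the criterion
    asks that it be multiplication by an element.  Using graphs avoids
    quantifying over the submodule type of the ideal. *)
Definition baer := forall (G : set (R * E)),
  G (0, 0) ->
  (forall a p q, G p -> G q -> G (a * p.1 + q.1, a *: p.2 + q.2)) ->
  (forall x, G (0, x) -> x = 0) ->
  exists e, forall p, G p -> p.2 = p.1 *: e.

(** Baer's criterion.  A maximal partial extension of [f] along [g], seen as a
    graph in [N * E], is everywhere defined: if [n] is outside of its domain,
    the elements [r] with [r *: n] in the domain form an ideal, and the element
    provided by the criterion extends the graph to [n]. *)
Lemma baer_injective : baer -> injective_module E.
Proof.
move=> baerE M N g f gi.
pose graph (A : set (N * E)) :=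
  [/\ forall m, A (g m, f m),
      forall a p q, A p -> A q -> A (a *: p.1 + q.1, a *: p.2 + q.2)
    & forall x, A (0, x) -> x = 0].
(* The empty set is admitted because the union of the empty chain is empty; it
   is not maximal. *)
have [|A [[A0|[Af Al A0]] Amax]] := @Zorn_bigcup _ (fun A => A = set0 \/ graph A).
- move=> F FP totF; rewrite /=.
  have [[A FA An0]|noA] := pselect (exists2 A, F A & A <> set0); last first.
    left; apply/seteqP; split=> // p [B FB Bp]; apply: noA; exists B => //.
    by move=> B0; rewrite B0 in Bp.
  right; split=> [m|a p q [B FB Bp] [C FC Cq]|x [B FB Bx]].
  + by exists A => //; have [//|[+ _ _]] := FP _ FA; exact.
  + have [D [FD Dp Dq]] : exists D, [/\ F D, D p & D q].
      by have [BC|CB] := totF _ _ FB FC; [exists C|exists B]; split=> //; auto.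
    exists D => //; have [D0|[_ + _]] := FP _ FD; last exact.
    by rewrite D0 in Dp.
  + have [B0|[_ _]] := FP _ FB; last exact.
    by rewrite B0 in Bx.
- exfalso; apply: (Amax [set p | exists m, p = (g m, f m)]).
    rewrite A0 properEneq; split=> //; apply/eqP => e.
    have : [set p | exists m, p = (g m, f m)] (g 0, f 0) by exists 0.
    by rewrite -e.
  right; split=> [m|a _ _ [m ->] [m' ->]|x [m [/esym g0 ->]]]; first by exists m.
    by exists (a *: m + m'); rewrite !linearP.
  by rewrite -(linear0 g) in g0; rewrite (gi _ _ g0) linear0.
have tot n : exists y, A (n, y).
  have A00 : A (0, 0) by rewrite -(linear0 g) -(linear0 f).
  have [|a p q|x|e eP] := baerE [set p | A (p.1 *: n, p.2)].
  - by rewrite /= scale0r.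
  - by rewrite /= scalerDl -scalerA; exact: (Al a (_, _) (_, _)).
  - by rewrite /= scale0r; exact: A0.
  exists e; apply: contrapT => nA.
  apply: (Amax [set p | exists2 q, A q & exists r, p = (r *: n + q.1, r *: e + q.2)]).
    rewrite properEneq; split.
      apply/eqP => e'; apply: nA; rewrite e'.
      by exists (0, 0) => //; exists 1; rewrite /= !scale1r !addr0.
    by move=> q Aq; exists q => //; exists 0; rewrite !scale0r !add0r; case: q {Aq}.
  right; split=> [m|a _ _ [q Aq [r ->]] [q' Aq' [r' ->]]|x [[q1 q2] Aq [r [/esym/eqP]]]].
  - by exists (g m, f m) => //; exists 0; rewrite /= !scale0r !add0r.
  - exists (a *: q.1 + q'.1, a *: q.2 + q'.2); first exact: Al.
    by exists (a * r + r'); congr pair;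
      by rewrite /= scalerDr scalerDl -scalerA addrACA.
  rewrite /= addrC addr_eq0 => /eqP q1E ->.
  have := eP (- r, q2); rewrite /= scaleNr -q1E => -> //.
  by rewrite scaleNr subrr.
have [h hP] := @linear_of_graph _ _ _ (fun n y => A (n, y))
  (fun a x y x' y' => Al a (x, y) (x', y')) tot A0.
by exists h => m; apply/hP.
Qed.

Lemma injective_baer : injective_module E -> baer.
Proof.
move=> injE G G0 Gl G1.
have cl : submod_closed [pred r : R^o | `[< exists x, G (r, x) >]].
  split=> [|a x y /asboolP[u Gu] /asboolP[v Gv]]; apply/asboolP.
    by exists 0.
  by exists (a *: u + v); exact: (Gl a (x, u) (y, v)).
pose J : submodule R^o := Submodule cl.
have [|x||k kP] := @linear_of_graph _ (subm J) E (fun r x => G (val r, x)).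
- by move=> a x y x' y'; exact: (Gl a (_, _) (_, _)).
- exact/asboolP/(valP x).
- exact: G1.
have [h hk] := injE _ _ (val : subm J -> R^o) k val_inj.
exists (h 1) => -[r x] Gp /=.
have rJ : (r : R^o) \in J by apply/asboolP; exists x.
have /kP <- : G (val (in_subm rJ), x) by [].
rewrite -hk /= -linearZ; congr (h _).
by rewrite /GRing.scale /= mulr1.
Qed.
End Baer.

(** Over a noetherian ring a map from an ideal to a direct sum only meets finitely
    many summands, namely those where some generator has a nonzero component
    (the set [A]); so the elements found in each summand by Baer's criterion can
    be truncated to [A] and form an element of the direct sum. *)
Lemma dsum_injective (R : comPzRingType) (I : choiceType) (E : I -> lmodType R) :
  noetherian R -> (forall i, injective_module (E i)) ->
  injective_module (dsum E).
Proof.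
move=> noeth injE; apply: baer_injective => G G0 Gl G1.
have Gfun r x y : G (r, x) -> G (r, y) -> x = y.
  move=> Gx Gy; apply/eqP; rewrite -subr_eq0 addrC -scaleN1r; apply/eqP/G1.
  by rewrite -(addNr r) -(mulN1r r); exact: (Gl (-1) (r, y) (r, x)).
have cl (P : set (dsum E)) : P 0 -> (forall a x y, P x -> P y -> P (a *: x + y)) ->
    submod_closed [pred r : R^o | `[< exists2 x, G (r, x) & P x >]].
  move=> P0 Pl; split=> [|a x y /asboolP[u Gu Pu] /asboolP[v Gv Pv]]; apply/asboolP.
    by exists 0.
  by exists (a *: u + v); [exact: (Gl a (x, u) (y, v))|exact: Pl].
pose J := Submodule (@cl setT Logic.I (fun _ _ _ _ _ => Logic.I)).
have [s Js] := noeth J.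
have /choice[x_ x_P] : forall r : R, exists x, (r : R^o) \in s -> G (r, x).
  move=> r; have [rs|] := boolP ((r : R^o) \in s); last by exists 0.
  have : (r : R^o) \in J by rewrite Js; exact: mem_span.
  by move=> /asboolP[x Gx _]; exists x.
pose A := \bigcup_(r in [set r | (r : R^o) \in s]) [set i | x_ r i <> 0].
have finA : finite_set A.
  by apply: bigcup_finite; [exact: finite_seq|move=> r _; exact: dsum_finite].
have GA r x : G (r, x) -> forall i, ~ A i -> x i = 0.
  move=> Gx; pose P := [set x : dsum E | forall i, ~ A i -> x i = 0].
  have P0 : P 0 by [].
  have Pl a u v : P u -> P v -> P (a *: u + v).
    by move=> Pu Pv i Ai /=; rewrite Pu// Pv// scaler0 addr0.
  pose K := Submodule (cl P P0 Pl).
  have : (r : R^o) \in K.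
    have : (r : R^o) \in J by apply/asboolP; exists x.
    rewrite Js; apply: span_sub => t ts; apply/asboolP.
    exists (x_ t); first exact: x_P.
    by move=> i Ai; apply: contrapT => xi; apply: Ai; exists t.
  by move=> /asboolP[y Gy yP] i Ai; rewrite (Gfun _ _ _ Gx Gy) yP.
have eP i : {e | forall p, G p -> p.2 i = p.1 *: e}.
  apply: cid; have := injective_baer (injE i).
  move=> /(_ [set p | exists2 x, G (p.1, x) & p.2 = x i])[].
  - by exists 0.
  - move=> a p q [x Gx ->] [y Gy ->]; exists (a *: x + y) => //=.
    exact: (Gl a (_, _) (_, _)).
  - by move=> y [x Gx /= ->]; rewrite (G1 x).
  - by move=> e eP; exists e => -[r x] Gx; apply: (eP (r, x i)); exists x.
have fe : finite_set [set i | (if i \in A then sval (eP i) else 0) <> 0].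
  apply: sub_finite_set finA => i /=; case: ifPn => [|_ //].
  by rewrite inE.
exists (Dsum fe) => -[r x] Gx; apply: dsumP => i /=.
case: ifPn => [_|]; first exact: (svalP (eP i) (r, x)).
by rewrite notin_setE => Ai; rewrite (GA _ _ Gx) ?scaler0.
Qed.

(** The ideals of the integers are principal, so Baer's criterion is divisibility
    by the least positive integer where the partial map is defined. *)
Lemma divisible_injective (D : lmodType int) :
  (forall (n : int) (x : D), n != 0 -> exists y, n *: y = x) ->
  injective_module D.
Proof.
move=> divD; apply: baer_injective => G G0 Gl G1.
have [nz|noG] := pselect (exists n : nat, (0 < n)%N && `[< exists x, G (n%:Z, x) >]);
  last first.
  exists 0 => -[r x] Gx /=; rewrite scaler0.
  have [r0|r0] := eqVneq r 0; first by apply: G1; rewrite -r0.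
  exfalso; apply: noG; exists `|r|%N; rewrite absz_gt0 r0 /=; apply/asboolP.
  have [r_ge0|r_lt0] := leP 0 r; first by exists x; rewrite gez0_abs.
  exists (- x); rewrite ltz0_abs //.
  have := Gl (-1) _ _ Gx G0; rewrite /= !addr0 mulN1r.
  by rewrite scaleN1r.
case: (ex_minnP nz) => n /andP[n_gt0 /asboolP[x Gx]] nmin.
have n0 : n%:Z != 0 by rewrite -lt0n.
have [y yx] := divD _ x n0.
exists y => -[r z] Gz /=.
have := Gl (- (r %/ n)%Z) _ _ Gx Gz; rewrite /= => Gm.
have rE : - (r %/ n)%Z * n + r = (r %% n)%Z by rewrite /modz mulNr addrC.
rewrite rE in Gm.
have m0 : (r %% n)%Z = 0.
  apply/eqP; apply: contraT => m0.
  have m_ge0 : 0 <= (r %% n)%Z by exact: modz_ge0.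
  have /nmin : (0 < `|(r %% n)%Z|)%N &&
      `[< exists x, G (`|(r %% n)%Z|%N%:Z, x) >].
    rewrite absz_gt0 m0; apply/asboolP; rewrite gez0_abs //.
    by exists (- (r %/ n)%Z *: x + z).
  by rewrite -lez_nat gez0_abs // leNgt ltz_pmod.
move: Gm; rewrite m0 => /G1/eqP; rewrite scaleNr addrC subr_eq0 => /eqP ->.
rewrite -yx scalerA; congr (_ *: _); symmetry.
by rewrite [LHS](divz_eq r n) m0 addr0.
Qed.

Section DivisibleExtension.
Variable A : lmodType int.

Let F : lmodType int := dsum (fun _ : A => zmodule rat).

Fact divisible_ext_closed : submod_closed [pred f : F |
  `[< exists2 g : free int A, (forall a, f a = (g a : int)%:~R)
      & free_lift idfun g = 0 >]].
Proof.
split=> [|n f f' /asboolP[g fg g0] /asboolP[g' fg' g0']]; apply/asboolP.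
  by exists 0; rewrite ?linear0.
exists (n *: g + g'); last by rewrite linearP /= g0 g0' scaler0 addr0.
by move=> a /=; rewrite fg fg' scalezrE rmorphD /= -mulrzr -rmorphM /= mulrC.
Qed.
(** An abelian group [A] is a quotient of a free group by some K; replacing the
    free group by the rational vector space on the same basis and keeping K gives
    a divisible group that contains [A].  Here the basis is [A] itself. *)
Definition divisible_ext : lmodType int := quotm (Submodule divisible_ext_closed).

Lemma divisible_ext_divisible (n : int) (x : divisible_ext) :
  n != 0 -> exists y, n *: y = x.
Proof.
move=> n0; have [f <-] := quotm_pi_surj x.
have fin : finite_set [set a | (n%:~R^-1 * (f a : rat) : zmodule rat) <> 0].
  apply: sub_finite_set (dsum_finite f) => a /= nfa fa.
  by apply: nfa; rewrite fa mulr0.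
exists (quotm_pi _ (Dsum fin : F)); rewrite -linearZ; congr quotm_pi.
apply: dsumP => a /=; rewrite scalezrE -mulrzl mulrA divff ?mul1r //.
by rewrite intr_eq0.
Qed.

Fact delta_rat_finite (a : A) :
  finite_set [set b | ((b == a)%:R : zmodule rat) <> 0].
Proof.
apply: (sub_finite_set _ (finite_set1 a)) => s /=.
by case: eqP => [->//|_ /(_ erefl)].
Qed.
Let delta_rat (a : A) : F := Dsum (delta_rat_finite a).

Fact divisible_embed_linear : linear (fun a => quotm_pi _ (delta_rat a) : divisible_ext).
Proof.
move=> n a b; rewrite -linearP; apply/quotm_pi_eq/asboolP.
exists (delta int (n *: a + b) - (n *: delta int a + delta int b)).
  move=> c /=; rewrite scalezrE -mulrzr.
  by rewrite rmorphB rmorphD rmorphM /= !mulrz_nat mulrC.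
by rewrite linearB linearP /= !free_lift_delta subrr.
Qed.
Definition divisible_embed : {linear A -> divisible_ext} := linear_of divisible_embed_linear.

Lemma divisible_embed_inj : injective divisible_embed.
Proof.
apply: inj_of_ker => a /quotm_pi0/asboolP[g ga g0].
suff ge : g = delta int a by rewrite -[a](free_lift_delta idfun) -ge.
apply: dsumP => b; apply: (@intr_inj rat); rewrite -ga /=.
by rewrite mulrz_nat.
Qed.
End DivisibleExtension.

Section Coinduced.
Variables (R : comPzRingType) (D : lmodType int).

(** Coinduction, the right adjoint of the forgetful functor from [R]-modules to
    abelian groups. *)
Record coind := Coind {
  coind_fun :> R -> D;
  coind_add : forall x y, coind_fun (x + y) = coind_fun x + coind_fun y }.
HB.instance Definition _ := gen_eqMixin coind.
HB.instance Definition _ := gen_choiceMixin coind.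
Implicit Types f g h : coind.

Lemma coindP f g : (forall r, f r = g r) -> f = g.
Proof.
case: f g => [f Ff] [g Fg] /= fg0; have fg := functional_extensionality_dep fg0.
by clear fg0; move: Ff Fg; rewrite fg => Ff Fg; rewrite (Prop_irrelevance Ff Fg).
Qed.

Definition coind_zero := @Coind (fun _ => 0) (fun _ _ => esym (addr0 _)).
Fact coind_opp_add f x y : - f (x + y) = - f x + - f y.
Proof. by rewrite coind_add opprD. Qed.
Definition coind_opp f := Coind (coind_opp_add f).
Fact coind_add_add f g x y : f (x + y) + g (x + y) = (f x + g x) + (f y + g y).
Proof. by rewrite !coind_add addrACA. Qed.
Definition coind_plus f g := Coind (coind_add_add f g).
Fact coind_scale_add (a : R) f x y : f ((x + y) * a) = f (x * a) + f (y * a).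
Proof. by rewrite mulrDl coind_add. Qed.
Definition coind_scale a f := @Coind (fun x => f (x * a)) (coind_scale_add a f).

Fact coind_addA : associative coind_plus.
Proof. by move=> f g h; apply: coindP => i /=; rewrite addrA. Qed.
Fact coind_addC : commutative coind_plus.
Proof. by move=> f g; apply: coindP => i /=; rewrite addrC. Qed.
Fact coind_add0 : left_id coind_zero coind_plus.
Proof. by move=> f; apply: coindP => i /=; rewrite add0r. Qed.
Fact coind_addN : left_inverse coind_zero coind_opp coind_plus.
Proof. by move=> f; apply: coindP => i /=; rewrite addNr. Qed.
HB.instance Definition _ :=
  GRing.isZmodule.Build coind coind_addA coind_addC coind_add0 coind_addN.

Fact coind_scaleA a b f : coind_scale a (coind_scale b f) = coind_scale (a * b) f.
Proof. by apply: coindP => i /=; rewrite mulrA. Qed.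
Fact coind_scale1 : left_id 1 coind_scale.
Proof. by move=> f; apply: coindP => i /=; rewrite mulr1. Qed.
Fact coind_scaleDr : right_distributive coind_scale +%R.
Proof. by move=> a f g; apply: coindP. Qed.
Fact coind_scaleDl f : {morph coind_scale^~ f : a b / a + b}.
Proof. by move=> a b; apply: coindP => i /=; rewrite mulrDr coind_add. Qed.
HB.instance Definition _ := GRing.Zmodule_isLmodule.Build R coind
  coind_scaleA coind_scale1 coind_scaleDr coind_scaleDl.

Lemma zlinear (M : zmodType) (f : M -> D) :
  (forall x y, f (x + y) = f x + f y) ->
  linear (f : zmodule M -> D).
Proof.
move=> fD; have f0 : f 0 = 0 by apply: (addrI (f 0)); rewrite -fD !addr0.
have fN x : f (- x) = - f x.
  by apply/eqP; rewrite -addr_eq0 -fD addNr f0.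
have fMn n x : f (x *+ n) = f x *+ n.
  by elim: n => [|n IH]; rewrite ?mulr0n ?f0 // !mulrS fD IH.
move=> n x y; rewrite fD -[n in RHS]intz scaler_int; congr (_ + _).
by case: n => n; rewrite scalezrE /intmul ?fN fMn.
Qed.

Lemma zlinearZ (M : lmodType R) (g : {linear zmodule M -> D}) x y :
  g (x + y : M) = g x + g y.
Proof. exact: linearD. Qed.

(** Linear maps from [M] to [coind] are additive maps from [M] to [D], through
    evaluation at 1. *)
Lemma coind_injective : injective_module D -> injective_module coind.
Proof.
move=> injD M N g f gi.
have gZ : linear (g : zmodule M -> zmodule N).
  by move=> n x y; rewrite !scalezrE /= linearD raddfMz.
have fZ : linear (fun m : zmodule M => f m 1).
  by apply: (@zlinear M (fun m => f m 1)) => x y; rewrite linearD.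
have [h hE] := injD _ _ (linear_of gZ) (linear_of fZ) gi.
have hadd n (r s : R) : h ((r + s) *: (n : N)) = h (r *: (n : N)) + h (s *: (n : N)).
  by rewrite scalerDl zlinearZ.
pose k n := Coind (hadd n).
have klin : linear (k : N -> coind).
  move=> a n n'; apply: coindP => r /=.
  by rewrite scalerDr zlinearZ scalerA.
exists (linear_of klin) => m; apply: coindP => r /=.
rewrite -linearZ [LHS]hE.
have -> : f m r = (r *: f m) 1 by rewrite /= mul1r.
by rewrite -linearZ.
Qed.
End Coinduced.

(** Let j embed the group underlying [M] in a divisible group D; then m is sent to
    the additive map r |-> j (r m) from [R] to D, whose value at 1 is j m. *)
Theorem enough_injectives (R : comPzRingType) (M : lmodType R) :
  exists (E : lmodType R) (e : {linear M -> E}), injective_module E /\ injective e.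
Proof.
pose j := divisible_embed (zmodule M).
have eadd m (r s : R) : j ((r + s) *: (m : M)) = j (r *: (m : M)) + j (s *: (m : M)).
  by rewrite scalerDl zlinearZ.
have elin : linear (fun m : M => Coind (eadd m)).
  move=> a m m'; apply: coindP => r /=.
  by rewrite scalerDr zlinearZ scalerA.
exists (coind R (divisible_ext (zmodule M))), (linear_of elin); split.
  exact/coind_injective/divisible_injective/divisible_ext_divisible.
move=> m m' /(congr1 (fun f : coind _ _ => f 1)) /=; rewrite !scale1r.
exact: divisible_embed_inj.
Qed.

(** * Vanishing of local cohomology by dimension shifting *)
Section Vanishing.
Variables (R : comPzRingType) (a : ideal R).
Implicit Types M N K L E B C X : lmodType R.

Local Notation tor x := (x \in torsion a _).

Lemma torsion_map M N (f : {linear M -> N}) x : tor x -> tor (f x).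
Proof.
move=> /asboolP[n nx]; apply/asboolP; exists n => r /nx rx.
by rewrite -linearZ rx linear0.
Qed.

Lemma torsion_inj M N (f : {linear M -> N}) x :
  injective f -> tor (f x) -> tor x.
Proof.
move=> fi /asboolP[n nx]; apply/asboolP; exists n => r /nx rx.
by apply: fi; rewrite linearZ /= rx linear0.
Qed.

Definition torsion_lifts M N (g : {linear M -> N}) :=
  forall z, tor z -> exists2 y, tor y & g y = z.

(** Vanishing of H^i_a, by H^0_a(M) = Gamma_a(M), H^1_a(M) = coker (Gamma_a(E) ->
    Gamma_a(C)) and H^(i+1)_a(M) = H^i_a(C) for i > 0, where 0 -> M -> E -> C -> 0
    with E injective.  Quantifying over all such sequences makes hypotheses easy
    to use; that one sequence is enough is [lc_vanish1] and
    [lc_vanish_cosyzygy]. *)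
Fixpoint lc_vanish (i : nat) M : Prop :=
  if i is i'.+1 then
    forall E C (f : {linear M -> E}) (g : {linear E -> C}),
      injective_module E -> short_exact f g ->
      if i' is 0 then torsion_lifts g else lc_vanish i' C
  else forall x : M, tor x -> x = 0.

Lemma cosyzygy_exists M : exists (E C : lmodType R) (f : {linear M -> E}) (g : {linear E -> C}),
  injective_module E /\ short_exact f g.
Proof.
have [E [f [injE fi]]] := enough_injectives M.
by exists E, (quotm (imm f)), f, (quotm_pi _); split=> //; exact: short_exact_coker.
Qed.

(** A retract up to maps that factor through an injective module. *)
Definition stable_retract (C' C : lmodType R) := exists (F : lmodType R) (u : {linear C -> C'})
  (v : {linear C' -> C}) (p : {linear C' -> F}) (q : {linear F -> C'}),
  injective_module F /\ forall x, x = u (v x) + q (p x).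

Lemma stable_retract_refl C : stable_retract C C.
Proof.
have [F [_ [_ [_ [injF _]]]]] := cosyzygy_exists C.
by exists F, idfun, idfun, \0, \0; split=> // x; rewrite /= addr0.
Qed.

(** Two cosyzygies of the same module are stably isomorphic, and more generally
    cosyzygies preserve stable retracts: extend the maps to the injective modules
    and observe that the error term vanishes on [C'], so that it comes from a map
    [s] defined on [X'].  The map [w] is what transports torsion lifts. *)
Lemma stable_retract_cosyzygy C E X (f : {linear C -> E}) (g : {linear E -> X})
    C' E' X' (f' : {linear C' -> E'}) (g' : {linear E' -> X'}) :
  stable_retract C' C -> injective_module E -> injective_module E' ->
  short_exact f g -> short_exact f' g' ->
  exists (w : {linear E -> E'}) (u : {linear X -> X'}) (v : {linear X' -> X})
    (s : {linear X' -> E'}),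
    (forall e, g' (w e) = u (g e)) /\ forall x, x = u (v x) + g' (s x).
Proof.
move=> [F [u [v [p [q [injF uvqp]]]]]] injE injE' [fi gs fg] [fi' gs' fg'].
have gf x : g (f x) = 0 by apply/fg; exists x.
have gf' x : g' (f' x) = 0 by apply/fg'; exists x.
have [w wf] := injE' _ _ f (f' \o u) fi.
have [z zf] := injE _ _ f' (f \o v) fi'.
have [t tf] := injF _ _ f' p fi'.
have [|ub ubP] := @factor_surj _ _ _ _ g (g' \o w) gs.
  by move=> _ /fg[x <-] /=; have /= -> := wf x; exact: gf'.
have [|vb vbP] := @factor_surj _ _ _ _ g' (g \o z) gs'.
  by move=> _ /fg'[x <-] /=; have /= -> := zf x; exact: gf.
have [|s sP] := @factor_surj _ _ _ _ g' (idfun \- (w \o z) \- (f' \o (q \o t))) gs'.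
  move=> _ /fg'[x <-] /=; have /= -> := zf x; have /= -> := wf (v x).
  have /= -> := tf x; rewrite -!linearB -addrA -opprD -uvqp subrr.
  exact: linear0.
exists w, ub, vb, s; split=> [e|x]; first by rewrite ubP.
have [e <-] := gs' x; rewrite vbP sP /= ubP /= !linearB /= gf' subr0.
by rewrite addrC subrK.
Qed.

Lemma lc_vanish_retract i C C' :
  stable_retract C' C -> lc_vanish i.+1 C -> lc_vanish i.+1 C'.
Proof.
elim: i C C' => [|i IH] C C' CC' VC E' X' f' g' injE' s'.
  have [E [X [f [g [injE s]]]]] := cosyzygy_exists C.
  have [w [u [v [t [wu xE]]]]] := stable_retract_cosyzygy CC' injE injE' s s'.
  move=> z Tz; have [y Ty yz] := VC _ _ _ _ injE s _ (torsion_map v Tz).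
  exists (w y + t z); last by rewrite linearD wu yz -xE.
  by rewrite rpredD ?torsion_map.
have [E [X [f [g [injE s]]]]] := cosyzygy_exists C.
have [w [u [v [t [wu xE]]]]] := stable_retract_cosyzygy CC' injE injE' s s'.
apply: (IH X); last exact: VC s.
by exists E', u, v, t, g'.
Qed.

Section Cosyzygy.
Variables (M E C : lmodType R) (f : {linear M -> E}) (g : {linear E -> C}).
Hypotheses (injE : injective_module E) (s : short_exact f g).

Lemma lc_vanish1 : lc_vanish 1 M <-> torsion_lifts g.
Proof.
split=> [VM|VM E' X' f' g' injE' s' z Tz]; first exact: VM s.
have [w [u [v [t [wu xE]]]]] :=
  stable_retract_cosyzygy (stable_retract_refl M) injE injE' s s'.
have [y Ty yz] := VM _ (torsion_map v Tz).
exists (w y + t z); last by rewrite linearD wu yz -xE.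
by rewrite rpredD ?torsion_map.
Qed.

Lemma lc_vanish_cosyzygy i : lc_vanish i.+2 M <-> lc_vanish i.+1 C.
Proof.
split=> [VM|VC E' X' f' g' injE' s']; first exact: VM s.
have [w [u [v [t [wu xE]]]]] :=
  stable_retract_cosyzygy (stable_retract_refl M) injE injE' s s'.
by apply: lc_vanish_retract VC; exists E', u, v, t, g'.
Qed.
End Cosyzygy.

(** The connecting map to H^1_a(K) for an arbitrary middle term: compare with
    K -> E -> X, and use that B embeds in E * C, so that an element of B is
    torsion when its images in E and C are. *)
Lemma lc_vanish1_lifts K B C (f : {linear K -> B}) (g : {linear B -> C}) :
  short_exact f g -> lc_vanish 1 K -> torsion_lifts g.
Proof.
move=> [fi gs fg] VK z Tz.
have [E [X [e [p [injE [ei ps ep]]]]]] := cosyzygy_exists K.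
have [w wf] := injE _ _ f e fi.
have [|h hP] := @factor_surj _ _ _ _ g (p \o w) gs.
  by move=> _ /fg[x <-] /=; have /= -> := wf x; apply/ep; exists x.
have [|y Ty yz] := VK _ _ e p injE _ _ (torsion_map h Tz); first by split.
have [b bz] := gs z.
have /ep[k kE] : p (w b - y) = 0 by rewrite linearB yz -bz hP subrr.
have wb : w (b - f k) = y.
  by rewrite linearB; have /= -> := wf k; rewrite kE opprB addrC subrK.
have gb : g (b - f k) = z.
  by rewrite linearB bz (_ : g (f k) = 0) ?subr0 //; apply/fg; exists k.
exists (b - f k) => //.
move: Tz Ty; rewrite -gb -wb; move: (b - f k) => c.
move=> /asboolP[m mc] /asboolP[n nc]; apply/asboolP; exists (m + n)%N => r rmn.
have /fg[x xE] : g (r *: c) = 0 by rewrite linearZ /= mc//; exact: idealX_subl rmn.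
have : w (r *: c) = 0 by rewrite linearZ /= nc//; exact: idealX_subr rmn.
rewrite -xE; have /= -> := wf x => ex0.
by rewrite (_ : x = 0) ?linear0 //; apply: ei; rewrite ex0 linear0.
Qed.

Section Rotation.
Variables (K M L : lmodType R) (f : {linear K -> M}) (g : {linear M -> L}).
Hypothesis s : short_exact f g.

(** With [E] injective containing [M], the quotients Q = E/K and Q' = E/M are
    cosyzygies of [K] and [M], and [L] = M/K is the kernel of Q -> Q'. *)
Lemma rotation : exists (E Q Q' : lmodType R) (m : {linear M -> E}) (c : {linear E -> Q})
    (c' : {linear E -> Q'}) (f' : {linear L -> Q}) (g' : {linear Q -> Q'}),
  [/\ injective_module E, short_exact (m \o f) c, short_exact m c' &
   [/\ short_exact f' g', forall x, f' (g x) = c (m x)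
     & forall e, g' (c e) = c' e]].
Proof.
have [fi gs fg] := s.
have [E [Q' [m [c' [injE s']]]]] := cosyzygy_exists M.
have [mi c's mc'] := s'.
have mfi : injective (m \o f) by move=> x y /mi/fi.
have s1 := short_exact_coker mfi; set c := quotm_pi _ in s1.
have [_ cs mfc] := s1.
have [|f' f'P] := @factor_surj _ _ _ _ g (c \o m) gs.
  by move=> _ /fg[x <-] /=; apply/mfc; exists x.
have [|g' g'P] := @factor_surj _ _ _ _ c c' cs.
  by move=> _ /mfc[x <-]; apply/mc'; exists (f x).
exists E, _, Q', m, c, c', f', g'; split=> //; split=> //; split.
- apply: inj_of_ker => x; have [y <-] := gs x.
  by rewrite f'P => /mfc[k /mi <-]; apply/fg; exists k.
- by move=> z; have [e <-] := c's z; exists (c e).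
move=> y; split=> [|[x <-]]; last first.
  by have [z <-] := gs x; rewrite f'P g'P; apply/mc'; exists z.
have [e <-] := cs y; rewrite g'P => /mc'[x <-].
by exists (g x); rewrite f'P.
Qed.

Lemma lc_vanish1_sub : lc_vanish 1 M -> torsion_lifts g -> lc_vanish 1 K.
Proof.
have [E [Q [Q' [m [c [c' [f' [g' [injE s1 s2 [s3 f'P g'P]]]]]]]]]] := rotation.
move=> /(lc_vanish1 injE s2) VM Tg; apply/(lc_vanish1 injE s1) => x Tx.
have [y Ty yx] := VM _ (torsion_map g' Tx).
have [f'i _ f'g'] := s3.
have /f'g'[l lE] : g' (x - c y) = 0 by rewrite linearB g'P yx subrr.
have Tl : tor l.
  by apply: (torsion_inj f'i); rewrite lE rpredB ?torsion_map.
have [k Tk kl] := Tg _ Tl.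
exists (y + m k); first by rewrite rpredD ?torsion_map.
by rewrite linearD -f'P kl lE addrC subrK.
Qed.

Lemma lc_vanish1_ext : lc_vanish 1 K -> lc_vanish 1 L -> lc_vanish 1 M.
Proof.
have [E [Q [Q' [m [c [c' [f' [g' [injE s1 s2 [s3 f'P g'P]]]]]]]]]] := rotation.
move=> /(lc_vanish1 injE s1) VK VL; apply/(lc_vanish1 injE s2) => x Tx.
have [y /VK[z Tz <-] <-] := lc_vanish1_lifts s3 VL Tx.
by exists z; rewrite // g'P.
Qed.

End Rotation.

(** Three consecutive pieces of the long exact sequence.  Rotation turns the first
    at degree i + 1 into the second at degree i, the second at degree i + 1 into
    the third at degree i, and the third into the first at the same degree, so
    they are proved together by induction. *)
Lemma lc_vanish_les i K M L (f : {linear K -> M}) (g : {linear M -> L}) :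
  short_exact f g ->
  [/\ lc_vanish i.+1 K -> lc_vanish i.+1 L -> lc_vanish i.+1 M,
      lc_vanish i.+1 M -> lc_vanish i.+2 K -> lc_vanish i.+1 L
    & lc_vanish i.+2 M -> lc_vanish i.+1 L -> lc_vanish i.+2 K].
Proof.
elim: i K M L f g => [|i IH] K M L f g s;
  have [E [Q [Q' [m [c [c' [f' [g' [injE s1 s2 [s3 f'P g'P]]]]]]]]]] := rotation s;
  have lK := lc_vanish_cosyzygy injE s1; have lM := lc_vanish_cosyzygy injE s2.
  split; first exact: lc_vanish1_ext s.
    move=> /(lc_vanish1 injE s2) VM /lK VQ; apply: (lc_vanish1_sub s3 VQ).
    move=> x /VM[y Ty <-]; exists (c y); rewrite ?g'P //; exact: torsion_map.
  by move=> /lM VQ' VL; apply/lK; exact: lc_vanish1_ext s3 VL VQ'.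
have [IH1 IH2 IH3] := IH _ _ _ _ _ s3.
(* The first piece at degree i + 2 for the rotated sequence L -> Q -> Q', by a
   second rotation; the third piece needs it. *)
have T1 : lc_vanish i.+2 L -> lc_vanish i.+2 Q' -> lc_vanish i.+2 Q.
  have [F [P [P' [n [d [d' [h [k [injF t1 t2 [t3 hP kP]]]]]]]]]] := rotation s3.
  have [_ J2 _] := IH _ _ _ _ _ t3.
  move=> VL VQ'; apply/(lc_vanish_cosyzygy injF t2)/J2.
    by apply/(lc_vanish_cosyzygy injF t1).
  exact: VQ'.
split.
- by move=> /lK VQ VL; apply/lM; exact: IH2.
- by move=> /lM VQ' /lK VQ; exact: IH3.
- by move=> /lM VQ' VL; apply/lK; exact: T1.
Qed.

Lemma lc_vanish_ext i K M L (f : {linear K -> M}) (g : {linear M -> L}) :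
  short_exact f g -> lc_vanish i K -> lc_vanish i L -> lc_vanish i M.
Proof.
move=> s; case: i => [VK VL x Tx|i]; last by have [+ _ _] := lc_vanish_les i s.
have [fi gs fg] := s.
have /fg[y yx] := VL _ (torsion_map g Tx).
rewrite -yx in Tx *; rewrite (VK y) ?linear0//; exact: torsion_inj Tx.
Qed.

Lemma lc_vanish_quot i K M L (f : {linear K -> M}) (g : {linear M -> L}) :
  short_exact f g -> lc_vanish i M -> lc_vanish i.+1 K -> lc_vanish i L.
Proof.
move=> s; case: i => [VM VK x Tx|i]; last by have [_ + _] := lc_vanish_les i s.
by have [y /VM -> <-] := lc_vanish1_lifts s VK Tx; rewrite linear0.
Qed.

Lemma lc_vanish_iso i M N (f : {linear M -> N}) :
  bijective f -> lc_vanish i M -> lc_vanish i N.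
Proof.
move=> [h fh hf]; case: i => [VM x Tx|i].
  rewrite -[x]hf (VM (h x)) ?linear0 //.
  by apply: (torsion_inj (can_inj fh)); rewrite hf.
apply: lc_vanish_retract.
have lh : linear h by move=> k x y; apply: (can_inj fh); rewrite linearP !hf.
have [F [_ [_ [_ [injF _]]]]] := cosyzygy_exists N.
exists F, f, (linear_of lh), \0, \0; split=> // x.
by rewrite /= hf addr0.
Qed.
End Vanishing.

(** * Direct sums and local cohomology *)
Section ChosenInjective.
Variables (R : comPzRingType) (M : lmodType R).

Definition chosen_injective : lmodType R := projT1 (cid (enough_injectives M)).
Definition to_injective : {linear M -> chosen_injective} :=
  projT1 (cid (projT2 (cid (enough_injectives M)))).

Lemma chosen_injectiveP : injective_module chosen_injective.
Proof. exact: (projT2 (cid (projT2 (cid (enough_injectives M))))).1. Qed.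

Lemma to_injective_inj : injective to_injective.
Proof. exact: (projT2 (cid (projT2 (cid (enough_injectives M))))).2. Qed.

Definition cosyzygy : lmodType R := quotm (imm to_injective).
Definition to_cosyzygy : {linear chosen_injective -> cosyzygy} :=
  quotm_pi (imm to_injective).

Lemma cosyzygy_short_exact : short_exact to_injective to_cosyzygy.
Proof. exact/short_exact_coker/to_injective_inj. Qed.
End ChosenInjective.

Section DsumMap.
Variables (R : comPzRingType) (T : choiceType) (M N : T -> lmodType R).
Variable f : forall t, {linear M t -> N t}.

Fact dsum_map_finite (x : dsum M) : finite_set [set t | f t (x t) <> 0].
Proof.
apply: sub_finite_set (dsum_finite x) => t /= nfx xt.
by apply: nfx; rewrite xt linear0.
Qed.
Fact dsum_map_linear : linear (fun x => Dsum (dsum_map_finite x)).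
Proof. by move=> a x y; apply: dsumP => t /=; rewrite linearP. Qed.
Definition dsum_map : {linear dsum M -> dsum N} := linear_of dsum_map_linear.

(** Lifts can be chosen componentwise, taking 0 above 0 to keep the support
    finite; [P] is a further condition imposed on the components. *)
Lemma dsum_lift (P : forall t, M t -> Prop) (y : dsum N) :
  (forall t, P t 0) -> (forall t, exists2 x, P t x & f t x = y t) ->
  exists2 x : dsum M, (forall t, P t (x t)) & dsum_map x = y.
Proof.
move=> P0 fy.
have /all_sig[x xP] t : {x | [/\ P t x, f t x = y t & y t = 0 -> x = 0]}.
  apply: cid; have [y0|y0] := pselect (y t = 0).
    by exists 0; split; rewrite // linear0.
  by have [x Px xy] := fy t; exists x.
have fin : finite_set [set t | x t <> 0].
  by apply: sub_finite_set (dsum_finite y) => t /= xt /(let: And3 _ _ h := xP t in h).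
exists (Dsum fin) => [t|]; first by case: (xP t).
by apply: dsumP => t /=; case: (xP t).
Qed.
End DsumMap.

Lemma dsum_short_exact (R : comPzRingType) (T : choiceType)
    (K M L : T -> lmodType R) (f : forall t, {linear K t -> M t})
    (g : forall t, {linear M t -> L t}) :
  (forall t, short_exact (f t) (g t)) -> short_exact (dsum_map f) (dsum_map g).
Proof.
move=> s; split=> [x y /(congr1 (fun z : dsum M => z : forall t, M t)) /= e|z|y].
- apply: dsumP => t; have [fi _ _] := s t; apply: fi.
  exact: (congr1 (fun z : forall t, M t => z t) e).
- have [//|t|y _ yz] := @dsum_lift _ _ _ _ g (fun _ _ => True) z; last by exists y.
  by have [_ gs _] := s t; have [y yz] := gs (z t); exists y.
split=> [gy|[x <-]]; last first.
  by apply: dsumP => t /=; have [_ _ fg] := s t; apply/fg; exists (x t).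
have [//|t|x _ xy] := @dsum_lift _ _ _ _ f (fun _ _ => True) y; last by exists x.
have [_ _ fg] := s t.
have /fg[x xy] : g t (y t) = 0 by rewrite -[RHS](congr1 (fun z : dsum L => z t) gy).
by exists x.
Qed.

Section DsumVanishing.
Variables (R : comPzRingType) (a : ideal R) (T : choiceType).
Hypothesis noethR : noetherian R.

Lemma idealX_le m n (r : R^o) : (m <= n)%N -> r \in idealX a n -> r \in idealX a m.
Proof. by move=> /subnKC <-; exact: idealX_subl. Qed.

Lemma torsion_dsum (M : T -> lmodType R) (x : dsum M) :
  (forall t, x t \in torsion a (M t)) <-> x \in torsion a (dsum M).
Proof.
split=> [xT|/asboolP[n nx] t]; last first.
  by apply/asboolP; exists n => r /nx /(congr1 (fun z : dsum M => z t)).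
have [s sx] : exists s : seq T, forall t, x t <> 0 -> t \in s.
  have /finite_seqP[s es] := dsum_finite x; exists s => t xt.
  by have : [set` s] t by rewrite -es.
have /choice[n nP] : forall t, exists n : nat,
    forall r : R^o, r \in idealX a n -> (r : R) *: x t = 0.
  by move=> t; have /asboolP := xT t.
apply/asboolP; exists (\max_(t <- s) n t)%N => r rn; apply: dsumP => t /=.
have [->|/sx ts] := pselect (x t = 0); first exact: scaler0.
by apply: nP; apply: idealX_le rn; exact: leq_bigmax_seq.
Qed.

(** Over a noetherian ring the direct sum of injective modules is injective, so a
    direct sum of cosyzygies is a cosyzygy of the direct sum. *)
Lemma lc_vanish_dsum i (M : T -> lmodType R) :
  (forall t, lc_vanish a i (M t)) -> lc_vanish a i (dsum M).
Proof.
elim: i M => [|i IH] M VM.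
  by move=> x /torsion_dsum Tx; apply: dsumP => t; exact: VM (Tx t).
have injE : injective_module (dsum (fun t => chosen_injective (M t))).
  by apply: dsum_injective => // t; exact: chosen_injectiveP.
have s := dsum_short_exact (fun t => cosyzygy_short_exact (M t)).
case: i IH VM => [|i] IH VM; last first.
  apply/(lc_vanish_cosyzygy a injE s)/IH => t.
  have := lc_vanish_cosyzygy a (@chosen_injectiveP _ (M t))
    (cosyzygy_short_exact (M t)) i.
  by move=> <-.
apply/(lc_vanish1 a injE s) => z /torsion_dsum Tz.
have [t|t|y Ty yz] := dsum_lift (f := fun t => to_cosyzygy (M t))
  (P := fun t x => x \in torsion a _) (y := z).
- exact: rpred0.
- apply: (iffLR (lc_vanish1 a (@chosen_injectiveP _ (M t))
    (cosyzygy_short_exact (M t)))) => //.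
- by exists y => //; apply/torsion_dsum.
Qed.
End DsumVanishing.

(** * Injective resolutions *)
Section HomologyZero.
Variables (R : comPzRingType) (X : complex R).

Lemma cyclesP l (x : X l) : (x \in cycles X l) <-> forall j, diff X l j x = 0.
Proof.
split=> [/kermP dx j|dx]; last exact/kermP.
have [->|lj] := eqVneq j (l - 1); first exact: dx.
by apply: diff_shape; apply: contra lj => /eqP ->; rewrite addrK.
Qed.

(** The degree [i] is existentially quantified although only [l + 1] contributes:
    this removes all casts between equal degrees. *)
Lemma homology0P l : zero_module (homology X l) <->
  forall x : X l, (forall j, diff X l j x = 0) ->
    exists i (y : X i), diff X i l y = x.
Proof.
split=> [H x /cyclesP dx|H h].
  have /quotm_pi0/asboolP[y yx] := H (quotm_pi _ (in_subm dx)).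
  by exists (l + 1), y.
have [z <-] := quotm_pi_surj h; apply/quotm_pi0/asboolP.
have [i [y yz]] := H (val z) (iffLR (cyclesP _) (valP z)).
have [il|il] := eqVneq i (l + 1); first by subst i; exists y.
by exists 0; rewrite linear0 -yz diff_shape.
Qed.
End HomologyZero.

Section ResolutionExists.
Variables (R : comPzRingType) (M : lmodType R).

Let C n : lmodType R := iter n (@cosyzygy R) M.
Let E n : lmodType R := chosen_injective (C n).
Let d n : {linear E n -> E n.+1} := to_injective (C n.+1) \o to_cosyzygy (C n).

(* The differential between any two indices, 0 unless they are consecutive; the
   cast is along the equation [n = m.+1]. *)
Let dd m n : {linear E m -> E n} :=
  if n =P m.+1 is ReflectT e then ecast k {linear E m -> E k} (esym e) (d m) else \0.

Let ddS m : dd m m.+1 = d m.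
Proof. by rewrite /dd; case: eqP => // e; rewrite (eq_axiomK e). Qed.

Let dd0 m n : n != m.+1 -> dd m n = \0.
Proof. by rewrite /dd; case: eqP. Qed.

Let d_eq0 n x : d n x = 0 <-> exists y, to_injective (C n) y = x.
Proof.
have [_ _ <-] := cosyzygy_short_exact (C n).
split=> [|/= ->]; last exact: linear0.
by rewrite /d /= -(linear0 (to_injective (C n.+1))) => /to_injective_inj.
Qed.

Let dd_dd m n k x : dd n k (dd m n x) = 0.
Proof.
have [->|nm] := eqVneq n m.+1; last by rewrite (dd0 nm) linear0.
have [->|kn] := eqVneq k m.+2; last by rewrite (dd0 kn).
by rewrite !ddS; apply/d_eq0; exists (to_cosyzygy (C m) x).
Qed.

Let obj (l : int) : lmodType R :=
  match l with
  | Posz 0 => E 0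
  | Posz _ => free R void
  | Negz n => E n.+1
  end.

Let odiff (i j : int) : {linear obj i -> obj j} :=
  match i, j with
  | Posz 0, Negz n => dd 0 n.+1
  | Negz m, Negz n => dd m.+1 n.+1
  | _, _ => \0
  end.

Let odiff_shape i j x : i != j + 1 -> odiff i j x = 0.
Proof.
case: i j x => [[|i]|i] [j|j] //= x ij; rewrite dd0 //; apply: contra ij.
  by move=> /eqP[->].
by move=> /eqP[->]; rewrite !NegzE; lia.
Qed.

Let odiff_diff i j k x : odiff j k (odiff i j x) = 0.
Proof.
case: i j k x => [[|i]|i] [[|j]|j] [[|k]|k] //= x; rewrite ?linear0 ?dd_dd //.
Qed.

Lemma injective_resolution_exists :
  exists (I : complex R) (e : {linear M -> I 0}), injective_resolution e.
Proof.
exists (Complex odiff_shape odiff_diff), (to_injective M); split.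
- case=> [[|l]|l]; try exact: chosen_injectiveP.
  by move=> V W g f gi; exists \0 => x; apply: dsumP; case.
- by case=> [[|l]|l] //= _ x; apply: dsumP; case.
- exact: to_injective_inj.
- by move=> x; have := @d_eq0 0 x; rewrite -ddS.
case=> // n _; apply/homology0P => x /= /(_ (Negz n.+1)) /=.
rewrite ddS => /d_eq0[y <-].
have [z <-] := quotm_pi_surj y.
case: n x y z => [|n] x y z; first by exists (Posz 0), z; rewrite /= ddS.
by exists (Negz n), z; rewrite /= ddS.
Qed.
End ResolutionExists.

Section ResolutionVanishing.
Variables (R : comPzRingType) (a : ideal R) (M : lmodType R) (I : complex R).
Variable e : {linear M -> I 0}.
Hypothesis resI : injective_resolution e.

Local Notation tor x := (x \in torsion a _).

Let exact_I l : l < 0 -> forall x : I l, (forall j, diff I l j x = 0) ->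
  exists y : I (l + 1), diff I (l + 1) l y = x.
Proof.
have [_ _ _ _ exI] := resI => l0 x dx.
have [i [y yx]] := iffLR (homology0P _ _) (exI _ l0) x dx.
have [il|il] := eqVneq i (l + 1); first by subst i; exists y.
by exists 0; rewrite linear0 -yx diff_shape.
Qed.

Let cyc l : lmodType R := subm (cycles I l).

Let to_cyc i j : i = j + 1 -> j < 0 ->
  exists2 g : {linear I i -> cyc j}, short_exact (val : cyc i -> I i) g
    & forall x, val (g x) = diff I i j x.
Proof.
move=> -> j0; have [|g gP] := @factor_inj _ _ _ _ (val : cyc j -> I j)
    (diff I (j + 1) j) val_inj.
  move=> y; have yc : diff I (j + 1) j y \in cycles I j.
    by apply/cyclesP => k; exact: diff_diff.
  by exists (in_subm yc).
exists g => //; split=> [|z|y]; first exact: val_inj.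
  have [y yz] := exact_I j0 (iffLR (cyclesP _) (valP z)).
  by exists y; apply: val_inj; rewrite gP.
split=> [gy|[x <-]]; last first.
  by apply: val_inj; rewrite gP; exact: (iffLR (cyclesP _) (valP x)).
have yc : y \in cycles I (j + 1); last by exists (in_subm yc).
apply/cyclesP => k; have [kj|kj] := eqVneq (j + 1) (k + 1).
  by rewrite -(addIr _ kj) -gP gy.
exact: diff_shape.
Qed.

Definition torsion_exact l := forall x : I l, tor x -> (forall j, diff I l j x = 0) ->
  exists i (y : I i), tor y /\ diff I i l y = x.

Let homology_torsion0P l :
  zero_module (homology (torsion_complex a I) l) <-> torsion_exact l.
Proof.
rewrite homology0P; split=> H x.
  move=> Tx dx; have [j|i [y yx]] := H (in_subm Tx).
    by apply: val_inj; rewrite /= dx.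
  by exists i, (val y); split; [exact: (valP y)|rewrite -[RHS](congr1 val yx)].
move=> dx; have [j|i [y [Ty yx]]] := H (val x) (valP x).
  exact: (congr1 val (dx j)).
by exists i, (in_subm Ty); apply: val_inj.
Qed.

Let lifts_exact i j (g : {linear I i -> cyc j}) : i = j + 1 ->
  (forall x, val (g x) = diff I i j x) ->
  torsion_lifts a g <-> torsion_exact j.
Proof.
move=> ij gP; split=> [lg x Tx dx|ex z Tz].
  have xc : x \in cycles I j by apply/cyclesP.
  have [|y Ty yx] := lg (in_subm xc); last first.
    by exists i, y; split=> //; rewrite -gP yx.
  by apply: (@torsion_inj _ _ _ _ (val : cyc j -> I j)) => //; exact: val_inj.
have [||k [y [Ty yz]]] := ex (val z).
- exact: (torsion_map (val : {linear cyc j -> I j}) Tz).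
- exact/cyclesP/(valP z).
have [ki|ki] := eqVneq k i.
  by subst k; exists y => //; apply: val_inj; rewrite gP.
exists 0; first exact: rpred0.
by apply: val_inj; rewrite linear0 -yz diff_shape // -ij.
Qed.

(* The cycles in one cohomological degree are a cosyzygy of those in the previous
   degree, so H^(k+1) of a module of cycles is H^1 of the cycles [k] degrees
   further, which is read off the torsion complex. *)
Let lc_vanish_cyc k m : lc_vanish a k.+1 (cyc (- m.+1%:Z)) <->
  torsion_exact (- (m + k).+2%:Z).
Proof.
have [injI _ _ _ _] := resI.
have ij : - m.+1%:Z = - m.+2%:Z + 1 by lia.
have [//|g s gP] := to_cyc ij.
elim: k m ij g s gP => [|k IH] m ij g s gP.
  by rewrite (lc_vanish1 _ (injI _) s) addn0; apply: lifts_exact gP.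
rewrite (lc_vanish_cosyzygy _ (injI _) s) -addSnnS.
have ij' : - m.+2%:Z = - m.+3%:Z + 1 by lia.
have [//|g' s' gP'] := to_cyc ij'.
exact: IH gP'.
Qed.

Lemma lc_vanish_resolution n :
  lc_vanish a n M <-> zero_module (homology (torsion_complex a I) (- n%:Z)).
Proof.
have [injI I0 ei e0 _] := resI.
rewrite homology_torsion0P; case: n => [|n].
  split=> [VM x Tx dx|ex m Tm].
    have /e0[m mx] := dx (-1); exists 0, 0; rewrite rpred0 linear0; split=> //.
    by rewrite -mx (VM m) ?linear0 //; apply: (torsion_inj ei); rewrite mx.
  have [|j|i [y [Ty ye]]] := ex (e m); first exact: torsion_map.
    have [<-|j1] := eqVneq (-1) j; first by apply/e0; exists m.
    apply: diff_shape; lia.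
  apply: ei; rewrite linear0 -ye.
  have [i1|i1] := eqVneq i (0 + 1); last exact: diff_shape.
  by subst i; rewrite (I0 1 _ y) ?linear0.
have [//|g s gP] := @to_cyc 0 (-1) erefl.
have s' : short_exact e g.
  split=> // [|y]; first by case: s.
  rewrite -e0 -gP; split=> [->|gy]; [exact: linear0|exact: val_inj].
case: n => [|n]; first by rewrite (lc_vanish1 _ (injI _) s'); exact: lifts_exact gP.
by rewrite (lc_vanish_cosyzygy _ (injI _) s'); exact: (lc_vanish_cyc n 0).
Qed.
End ResolutionVanishing.

(** * Vanishing above the number of generators *)
Section Bound.
Variables (R : comPzRingType).

(** For a finite list [xs] this is torsion for the ideal generated by [xs]
    ([torsion_nilpotent]); it is better suited to adding generators one by
    one. *)
Definition nilpotent_on (M : lmodType R) (xs : seq R) (w : M) :=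
  forall x, x \in xs -> exists k, x ^+ k *: w = 0.

Lemma nilpotent_on_map (M N : lmodType R) (f : {linear M -> N}) xs w :
  nilpotent_on xs w -> nilpotent_on xs (f w).
Proof.
by move=> nw x /nw[k xk]; exists k; rewrite -linearZ xk linear0.
Qed.

Lemma nilpotent_onD (M : lmodType R) xs (v w : M) :
  nilpotent_on xs v -> nilpotent_on xs w -> nilpotent_on xs (v + w).
Proof.
move=> nv nw x xx; have [k kv] := nv x xx; have [l lw] := nw x xx.
exists (k + l)%N; rewrite exprD scalerDr -[in X in _ + X]scalerA lw scaler0.
by rewrite mulrC -scalerA kv scaler0 addr0.
Qed.

(** The ideals (ann w : x^m) increase with m, hence are constant from some n on. *)
Lemma power_torsion_stable (M : lmodType R) (x : R) (w : M) : noetherian R ->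
  exists n, forall m r, x ^+ m *: (r *: w) = 0 -> x ^+ n *: (r *: w) = 0.
Proof.
move=> noethR.
have step m n (v : M) : (m <= n)%N -> x ^+ m *: v = 0 -> x ^+ n *: v = 0.
  by move=> /subnK <- mv; rewrite exprD -scalerA mv scaler0.
have cl : submod_closed [pred r : R^o | `[< exists m, x ^+ m *: (r *: w) = 0 >]].
  split=> [|k r s /asboolP[m mr] /asboolP[n ns]]; apply/asboolP.
    by exists 0; rewrite !scale0r scaler0.
  exists (maxn m n); rewrite scalerDl scalerDr (step _ _ _ (leq_maxr m n) ns).
  rewrite addr0 (_ : (k *: r) *: w = k *: (r *: w)); last by rewrite scalerA.
  rewrite scalerA mulrC -scalerA.
  by rewrite (step _ _ _ (leq_maxl m n) mr) scaler0.
have [s sP] := noethR (Submodule cl).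
have /choice[n_ nP] : forall r : R, exists n, (r : R^o) \in s -> x ^+ n *: (r *: w) = 0.
  move=> r; have [rs|] := boolP ((r : R^o) \in s); last by exists 0.
  have : (r : R^o) \in Submodule cl by rewrite sP; exact: mem_span.
  by move=> /asboolP[m mr]; exists m.
exists (\max_(r <- s) n_ r)%N => m r mr.
have : (r : R^o) \in Submodule cl by apply/asboolP; exists m.
pose f (r : R^o) := x ^+ (\max_(r <- s) n_ r)%N *: ((r : R) *: w).
have lf : linear f.
  move=> k u v; rewrite /f scalerDl scalerDr; congr (_ + _).
  rewrite (_ : (k *: u) *: w = k *: ((u : R) *: w)); last by rewrite scalerA.
  by rewrite !scalerA [x ^+ _ * k]mulrC.
rewrite sP => /(@span_sub _ _ _ (kerm (linear_of lf))) => H.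
apply/(kermP (linear_of lf))/H => t /= ts; apply/kermP.
by apply: (step _ _ _ _ (nP _ ts)); exact: leq_bigmax_seq.
Qed.

(** An injective module is x-divisible up to x-power torsion, and the quotient [v]
    of [w] by x^k can be found inside of the elements killed by ann w.  For [n]
    as in [power_torsion_stable], the rule x^(k+n) t + j |-> x^n t w, for j in
    ann w, is a well defined map on an ideal; [v] is the element that represents
    it.  Taking t = 0 shows that ann w kills [v], and t = 1 gives the equation. *)
Lemma injective_divide (E : lmodType R) xs (x : R) k (w : E) :
  noetherian R -> injective_module E -> nilpotent_on xs w ->
  exists2 v, nilpotent_on xs v & exists n, x ^+ n *: (w - x ^+ k *: v) = 0.
Proof.
move=> noethR injE nw; have [n nP] := power_torsion_stable x w noethR.
have [|a p q|y|v vP] := injective_baer injE (G := [set p : R * E |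
    exists t j, [/\ j *: w = 0, p.1 = x ^+ (k + n) * t + j & p.2 = x ^+ n *: (t *: w)]]).
- by exists 0, 0; rewrite !scale0r scaler0 mulr0 addr0.
- move=> [t [j [jw -> ->]]] [u [l [lw -> ->]]]; exists (a * t + u), (a * j + l).
  split=> /=.
  + by rewrite scalerDl -scalerA jw lw scaler0 addr0.
  + by rewrite !mulrDr addrACA !mulrA [a * _]mulrC.
  + by rewrite scalerDl scalerDr !scalerA !mulrA [a * _]mulrC.
- move=> [t [j [jw /= e ->]]]; apply: (nP (k + n)%N).
  by rewrite scalerA -[_ * t](addrK j) -e sub0r scaleNr jw oppr0.
exists v; last exists n.
  move=> y /nw[m ym]; exists m; apply/esym/(vP (y ^+ m, 0)).
  by exists 0, (y ^+ m); rewrite mulr0 add0r scale0r scaler0.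
have /= := vP (x ^+ (k + n), x ^+ n *: w) _.
rewrite scalerBr scalerA -exprD addnC => <-; first by rewrite subrr.
by exists 1, 0; rewrite scale0r mulr1 addr0 scale1r.
Qed.

(** Adding a generator raises the bound on cohomology by at most one.  A cycle [z]
    that is torsion for xs and x is the boundary of some y torsion for xs; for
    x^k z = 0 the element x^k y is a cycle, hence the boundary of some w, and
    dividing w by x^k corrects y into an element killed by a power of x.  The
    step uses the bound for xs in the two consecutive degrees l and l + 1. *)
Lemma nilpotent_exact (M : lmodType R) (I : complex R) (e : {linear M -> I 0})
    (xs : seq R) l (z : I l) :
  noetherian R -> injective_resolution e -> l < - (size xs)%:Z ->
  nilpotent_on xs z -> (forall j, diff I l j z = 0) ->
  exists2 y : I (l + 1), nilpotent_on xs y & diff I (l + 1) l y = z.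
Proof.
move=> noethR [injI _ _ _ exI].
elim: xs l z => [|x xs IH] l z /= ltl nz dz.
  have l0 : l < 0 by lia.
  have [i [y yz]] := iffLR (homology0P _ _) (exI _ l0) z dz.
  have [il|il] := eqVneq i (l + 1); first by subst i; exists y.
  by exists 0; rewrite // linear0 -yz diff_shape.
have nz' : nilpotent_on xs z by move=> t tx; apply: nz; rewrite in_cons tx orbT.
have [|y ny yz] := IH l z _ nz' dz; first lia.
have [k xz] := nz x (mem_head _ _).
have [|||w nw wy] := IH (l + 1) (x ^+ k *: y); first by lia.
- by move=> t /ny[m tm]; exists m; rewrite scalerA mulrC -scalerA tm scaler0.
- move=> j; have [lj|lj] := eqVneq j l.
    by subst j; rewrite linearZ yz.
  by apply: diff_shape; apply: contra lj => /eqP/addIr ->.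
have [v nv [m mP]] := @injective_divide _ xs x k w noethR (injI _) nw.
exists (y - diff I (l + 1 + 1) (l + 1) v); last by rewrite linearB diff_diff subr0.
move=> t; rewrite in_cons => /orP[/eqP->|tx]; last first.
  apply: nilpotent_onD tx => //; rewrite -scaleN1r -linearZ.
  apply: nilpotent_on_map => u /nv[p up]; exists p.
  by rewrite scalerA mulrC -scalerA up scaler0.
exists (m + k)%N; rewrite exprD -scalerA scalerBr -wy -linearZ -linearB -linearZ /=.
by rewrite mP linear0.
Qed.

Section ScaleOn.
Variables (M : lmodType R) (x : M).
Fact scale_on_linear : linear (fun r : R^o => (r : R) *: x).
Proof. by move=> k u v; rewrite scalerDl scalerA. Qed.
Definition scale_on : {linear R^o -> M} := linear_of scale_on_linear.
End ScaleOn.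

Lemma span_cons (M : lmodType R) (m : M) (s : seq M) u :
  u \in span [set` m :: s] ->
  exists (c : R) (b : M), b \in span [set` s] /\ u = c *: m + b.
Proof.
have cl : submod_closed [pred u : M |
    `[< exists (c : R) (b : M), b \in span [set` s] /\ u = c *: m + b >]].
  split=> [|k _ _ /asboolP[c [b [bs ->]]] /asboolP[c' [b' [bs' ->]]]]; apply/asboolP.
    by exists 0, 0; rewrite rpred0 scale0r addr0.
  exists (k * c + c'), (k *: b + b'); rewrite rpredD ?rpredZ //; split=> //.
  by rewrite scalerDr scalerDl addrACA -scalerA.
move=> /(@span_sub _ _ _ (Submodule cl)) H.
apply/asboolP/H => t tms; apply/asboolP; have : t \in m :: s by [].
rewrite in_cons => /orP[/eqP ->|ts].
  by exists 1, 0; rewrite rpred0 scale1r addr0.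
by exists 0, t; rewrite scale0r add0r mem_span.
Qed.

Lemma prod_span_cons (r : R^o) (s us : seq R^o) :
  (forall u, u \in us -> u \in span [set` r :: s]) ->
  exists bs c, [/\ size bs = size us, forall b, b \in bs -> b \in span [set` s]
    & \prod_(u <- us) (u : R) = \prod_(b <- bs) (b : R) + c * r].
Proof.
elim: us => [|u us IH] us_s.
  by exists [::], 0; split; rewrite // !big_nil mul0r addr0.
have [|bs [c [sz bs_s e]]] := IH; first by move=> v vu; apply: us_s; rewrite in_cons vu orbT.
have [d [b [b_s uE]]] := span_cons (us_s u (mem_head _ _)).
exists (b :: bs), (u * c + d * \prod_(b <- bs) (b : R)); split.
- by rewrite /= sz.
- by move=> v; rewrite in_cons => /orP[/eqP ->|/bs_s].
rewrite !big_cons e mulrDr {1}uE [in LHS]mulrDl [in RHS]mulrDl mulrA.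
by rewrite [d * _ * r]mulrAC -addrA addrC -addrA.
Qed.

(** If powers of the generators r, s kill x, then a power of the ideal does: a long
    product of elements of (r, s) is a product of elements of (s) plus a multiple
    of r, and both x and r x are dealt with by induction. *)
Lemma nilpotent_on_power (M : lmodType R) (s : seq R^o) (x : M) : nilpotent_on s x ->
  exists n, forall us : seq R^o, size us = n ->
    (forall u, u \in us -> u \in span [set` s]) -> (\prod_(u <- us) (u : R)) *: x = 0.
Proof.
elim: s x => [|r s IHs] x nx.
  exists 1%N => -[|u [|//]] //= _ us; rewrite big_seq1.
  have : u \in kerm (idfun : {linear R^o -> R^o}).
    by apply: span_sub (us u (mem_head _ _)).
  by move=> /kermP /= ->; rewrite scale0r.
have nx' : nilpotent_on s x by move=> t ts; apply: nx; rewrite in_cons ts orbT.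
have [k xk] := nx r (mem_head _ _).
elim: k x xk nx' {nx} => [|k IHk] x xk nx'.
  by exists 0%N => us _ _; rewrite -[x]scale1r -(expr0 r) xk scaler0.
have [||n nP] := IHk (r *: x); first by rewrite scalerA -exprSr.
  by move=> t /nx'[m tm]; exists m; rewrite scalerA mulrC -scalerA tm scaler0.
have [m mP] := IHs _ nx'.
exists (m + n)%N => us szu us_s.
rewrite -(cat_take_drop m us) big_cat /= mulrC -scalerA.
have [|bs [c [szb bs_s ->]]] := @prod_span_cons r s (take m us).
  by move=> u /mem_take; exact: us_s.
rewrite scalerDl mP //; last by rewrite szb size_takel // szu leq_addr.
rewrite add0r -scalerA scalerA mulrC -scalerA nP ?scaler0 //.
  by rewrite size_drop szu addKn.
by move=> u /mem_drop; exact: us_s.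
Qed.

Variables (a : ideal R) (s : seq R^o).
Hypothesis as_ : forall r, (r \in a) = (r \in span [set` s]).

Lemma torsion_nilpotent (M : lmodType R) (x : M) :
  (x \in torsion a M) <-> nilpotent_on s x.
Proof.
split=> [/asboolP[n nx] r rs|/nilpotent_on_power[n nP]].
  exists n; apply: nx; apply: mem_span; exists (fun=> r) => [i|].
    by rewrite /= as_ mem_span.
  by rewrite prodr_const card_ord.
apply/asboolP; exists n => r; move=> /(@span_sub _ _ _ (kerm (scale_on x))) H.
apply/(kermP (scale_on x))/H => _ [u ua <-]; apply/kermP => /=.
have := nP [seq u i | i <- enum 'I_n]; rewrite big_map big_enum /=.
apply; first by rewrite size_map size_enum_ord.
by move=> _ /mapP[i _ ->]; rewrite -as_; exact: ua.
Qed.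

(** The bound of [nilpotent_exact], read in one injective resolution. *)
Lemma lc_vanish_bound n (M : lmodType R) : noetherian R ->
  (size s < n)%N -> lc_vanish a n M.
Proof.
move=> noethR ltn; have [I [e resI]] := injective_resolution_exists M.
apply/(lc_vanish_resolution a resI)/homology0P => z dz.
have [|||y ny yz] := @nilpotent_exact M I e s _ (val z) noethR resI.
- by rewrite ltrN2 ltz_nat.
- exact/torsion_nilpotent/(valP z).
- by move=> j; exact: (congr1 val (dz j)).
have Ty : y \in torsion a _ by apply/torsion_nilpotent.
by exists (- n%:Z + 1), (in_subm Ty); apply: val_inj.
Qed.
End Bound.

(** * Comparison of local cohomology through annihilators *)
Section Annihilator.
Variable R : comPzRingType.

Fact ann_closed (M : lmodType R) :
  submod_closed [pred r : R^o | `[< forall x : M, (r : R) *: x = 0 >]].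
Proof.
split=> [|k r s /asboolP rM /asboolP sM]; apply/asboolP => x.
  exact: scale0r.
rewrite scalerDl sM addr0 (_ : (k *: r) *: x = k *: ((r : R) *: x)).
  by rewrite rM scaler0.
by rewrite scalerA.
Qed.
Definition ann (M : lmodType R) : ideal R := Submodule (@ann_closed M).

Lemma annP (M : lmodType R) (r : R^o) :
  (r \in ann M) <-> forall x : M, (r : R) *: x = 0.
Proof. by split=> /asboolP. Qed.

Definition ideal_le (b c : ideal R) := forall r, r \in b -> r \in c.

Definition ideal_adjoin (b : ideal R) (x : R^o) : ideal R :=
  span [set r | r \in b \/ r = x].

Lemma ideal_adjoin_le b (x : R^o) c :
  ideal_le b c -> x \in c -> ideal_le (ideal_adjoin b x) c.
Proof. by move=> bc xc r; apply: span_sub => t [/bc|->]. Qed.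

Lemma ideal_le_adjoin b x : ideal_le b (ideal_adjoin b x).
Proof. by move=> r br; apply: mem_span; left. Qed.

Lemma mem_adjoin b (x : R^o) : x \in ideal_adjoin b x.
Proof. by apply: mem_span; right. Qed.

(** The union of a chain of ideals is finitely generated, so its generators lie in
    one member and the chain has a largest element. *)
Lemma noetherian_max (S : ideal R -> Prop) b0 : noetherian R -> S b0 ->
  exists2 b, S b & forall c, ideal_le b c -> S c -> ideal_le c b.
Proof.
move=> noethR S0.
have [|A [[A0|[b Sb Ab]] Amax]] := @Zorn_bigcup _
    (fun A => A = set0 \/ exists2 b, S b & A = [set` (b : {pred R^o})]).
- move=> F FP totF; rewrite /=.
  have [[A FA An0]|noA] := pselect (exists2 A, F A & A <> set0); last first.
    left; apply/seteqP; split=> // p [B FB Bp]; apply: noA; exists B => //.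
    by move=> B0; rewrite B0 in Bp.
  right.
  have FI B x : F B -> B x -> exists2 b : ideal R, S b & B = [set` (b : {pred R^o})].
    by move=> FB Bx; have [B0|//] := FP _ FB; rewrite B0 in Bx.
  have [x Ax] : exists x, A x by apply/set0P/eqP.
  have cl : submod_closed [pred r | `[< (\bigcup_(X in F) X) r >]].
    split=> [|k r s /asboolP[B FB Br] /asboolP[C FC Cs]]; apply/asboolP.
      have [b _ Ab] := FI _ _ FA Ax.
      by exists A => //; rewrite Ab /=; exact: rpred0.
    have [D [FD Dr Ds]] : exists D, [/\ F D, D r & D s].
      by have [BC|CB] := totF _ _ FB FC; [exists C|exists B]; split=> //; auto.
    have [b _ Db] := FI _ _ FD Dr; exists D => //.
    rewrite Db in Dr Ds *; exact: (rpredD (rpredZ k Dr) Ds).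
  have [s sP] := noethR (Submodule cl).
  have [B FB sB] : exists2 B, F B & (B !=set0) /\ forall t, t \in s -> B t.
    have : forall t, t \in s -> (\bigcup_(X in F) X) t.
      by move=> t ts; apply/asboolP; have := mem_span (S := [set` s]) ts; rewrite -sP.
    elim: s {sP} => [|t s IH] sF; first by exists A => //; split=> //; exists x.
    have [|B FB [B0 sB]] := IH; first by move=> u us; apply: sF; rewrite in_cons us orbT.
    have [C FC Ct] := sF t (mem_head _ _).
    have [BC|CB] := totF _ _ FB FC; [exists C|exists B] => //; split.
    + by exists t.
    + by move=> u; rewrite in_cons => /orP[/eqP ->//|/sB/BC].
    + exact: B0.
    + by move=> u; rewrite in_cons => /orP[/eqP ->|/sB//]; exact: CB.
  have [[z Bz] sB'] := sB; have [b Sb Bb] := FI _ _ FB Bz.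
  exists b => //; apply/seteqP; split=> [r Fr|r br]; last by exists B => //; rewrite Bb.
  have : r \in Submodule cl by apply/asboolP.
  rewrite sP; apply: span_sub => t ts.
  by have := sB' _ ts; rewrite Bb.
- exfalso; apply: (Amax [set` (b0 : {pred R^o})]); last by right; exists b0.
  rewrite A0 properEneq; split=> //; apply/eqP => /esym e.
  have : [set` (b0 : {pred R^o})] 0 by exact: (rpred0 b0).
  by rewrite e.
exists b => // c bc Sc r rc; apply: contrapT => rb.
apply: (Amax [set` (c : {pred R^o})]); last by right; exists c.
rewrite Ab properEneq; split=> //; apply/eqP => e.
by apply: rb; have : [set` (c : {pred R^o})] r by []; rewrite -e.
Qed.

(** The data define a nonzero map from [M] to R/b: send [x] to the class of [r]
    where [s *: x] is [r *: m] modulo [L].  To find it, remove the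
    generators of [M] one by one: some s outside of b multiplies [M] into the
    span of all of them, none multiplies it into 0 because ann M is inside b, and
    [m] is the generator whose removal makes the difference, [L] the span of those
    that are left. *)
Lemma prime_coordinate (M : lmodType R) (b : ideal R) :
  fin_gen M -> prime_ideal b -> ideal_le (ann M) b ->
  exists (L : submodule M) (m : M) (s : R^o),
    [/\ s \notin b, forall x, exists r : R, (s : R) *: x - r *: m \in L
      & forall r : R, r *: m \in L -> (r : R^o) \in b].
Proof.
move=> [ms msP] [b1 bM] annb.
pose D (ns : seq M) := exists2 s : R^o, s \notin b & forall x : M, (s : R) *: x \in span [set` ns].
have : D ms by exists 1 => // x; rewrite scale1r; exact: msP.
elim: ms {msP} => [[s sb sM]|m ms IH [s sb sM]].
  exfalso; move: sb => /negP; apply; apply: annb; apply/annP => x.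
  have : (s : R) *: x \in kerm (idfun : {linear M -> M}) by exact: span_sub (sM x).
  by move/kermP.
have [/IH//|nD] := pselect (D ms).
exists (span [set` ms]), m, s; split=> // [x|r rm].
  by have [c [l [lL ->]]] := span_cons (sM x); exists c; rewrite addrC addKr.
apply: contrapT => rb; apply: nD; exists ((r * s : R) : R^o).
  by apply/negP => /bM[]//; apply/negP.
move=> x; rewrite -scalerA; have [c [l [lL ->]]] := span_cons (sM x).
rewrite scalerDr scalerA mulrC -scalerA.
by apply: rpredD; apply: rpredZ.
Qed.

Section TorsionClass.
Variables (M : lmodType R) (V : lmodType R -> Prop).
Hypotheses (noethR : noetherian R) (fgM : fin_gen M) (VM : V M).
Hypothesis V_ext : forall (N : lmodType R) (N' : submodule N),
  V (subm N') -> V (quotm N') -> V N.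
Hypothesis V_dsum : forall (T : choiceType) (N : lmodType R),
  V N -> V (dsum (fun _ : T => N)).
Hypothesis V_quot : forall (N L : lmodType R) (g : {linear N -> L}),
  ideal_le (ann M) (ann N) -> (forall z, exists y, g y = z) -> V N -> V L.

Lemma ann_quotm (N : lmodType R) (N' : submodule N) r :
  (forall x : N, (r : R) *: x \in N') -> (r : R^o) \in ann (quotm N').
Proof.
move=> rN; apply/annP => z; have [y <-] := quotm_pi_surj z.
by rewrite -linearZ; apply/quotm_pi0/rN.
Qed.

Lemma ann_subm (N : lmodType R) (N' : submodule N) (r : R^o) :
  (forall x, x \in N' -> (r : R) *: x = 0) -> r \in ann (subm N').
Proof. by move=> rN; apply/annP => x; apply: val_inj; exact: rN (valP x). Qed.

(** The cover of [N] by the free module on its own elements factors through the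
    copies of R/b, because b kills [N]. *)
Lemma dsum_cyclic_cover (b : ideal R) (N : lmodType R) : ideal_le b (ann N) ->
  exists g : {linear dsum (fun _ : N => quotm b) -> N}, forall z, exists y, g y = z.
Proof.
move=> bN.
have ds := dsum_short_exact (fun _ : N => short_exact_sub b).
have [_ ps _] := ds.
have [|g gP] := @factor_surj _ _ _ _ (dsum_map (fun _ : N => quotm_pi b))
    (free_lift (R := R) (fun n : N => n)) ps.
  move=> f f0; rewrite /= /free_lift; apply: fsbig1 => n _.
  apply: (iffLR (annP _ _)); apply/bN/quotm_pi0.
  exact: (congr1 (fun z : dsum _ => z n) f0).
exists g => z; exists (dsum_map (fun _ : N => quotm_pi b) (delta R z)).
by rewrite gP /= free_lift_delta.
Qed.

(** Noetherian induction: take b maximal among the ideals that contain ann M and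
    kill some module outside of the class.  If xy is in b with x, y outside of
    b, a module N killed by b is an extension of N/xN by xN, which are killed by
    larger ideals.  If b is prime, the image of the map M -> R/b of [prime_coordinate]
    is in the class as a quotient of M, and its cokernel is killed by s and b;
    so R/b is in the class, and with it every quotient of a direct sum of copies
    of R/b. *)
Theorem torsion_class_ann (N : lmodType R) : ideal_le (ann M) (ann N) -> V N.
Proof.
apply: contrapT => nV.
pose bad (b : ideal R) := ideal_le (ann M) b /\
  ~ forall N : lmodType R, ideal_le b (ann N) -> V N.
have [|b [Mb nb] bmax] := @noetherian_max bad (ann M) noethR.
  by split=> // H; apply: nV; exact: H.
apply: nb => {N nV}.
have good (x : R^o) (N : lmodType R) : x \notin b -> ideal_le b (ann N) -> x \in ann N -> V N.
  move=> xb bN xN; apply: contrapT => nVN; move: xb => /negP; apply.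
  apply: (bmax (ideal_adjoin b x)); first exact: ideal_le_adjoin.
    split=> [r /Mb|H]; first exact: ideal_le_adjoin.
    by apply/nVN/H/ideal_adjoin_le.
  exact: mem_adjoin.
have [b1|b1] := boolP ((1 : R^o) \in b).
  move=> N bN; have /annP N0 := bN _ b1.
  apply: (V_quot (g := \0 : {linear M -> N})) VM => // z.
  by exists 0; rewrite /= -[z]scale1r N0.
have [prb|nprb] := pselect (prime_ideal b); last first.
  have [x [y [xyb xb yb]]] : exists x y : R^o,
      [/\ ((x : R) * (y : R) : R^o) \in b, x \notin b & y \notin b].
    apply: contrapT => nxy; apply: nprb; split=> // x y xyb.
    apply: contrapT => /not_orP[xb yb]; apply: nxy.
    by exists x, y; split=> //; apply/negP.
  move=> N bN.
  have lx : linear (fun n : N => (x : R) *: n).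
    by move=> k u v; rewrite scalerDr !scalerA mulrC.
  apply: (V_ext (N' := imm (linear_of lx))).
    apply: (good y) => //.
      move=> r /bN/annP rN; apply/ann_subm => z /immP[n <-].
      by rewrite rN.
    apply/ann_subm => z /immP[n <-] /=; rewrite scalerA mulrC.
    by move: (bN _ xyb) => /annP.
  apply: (good x) => //.
    by move=> r /bN/annP rN; apply/ann_quotm => n; rewrite rN rpred0.
  by apply/ann_quotm => n; apply/immP; exists n.
have [L [m [s [sb sM mL]]]] := prime_coordinate fgM prb Mb.
have [|x|z|h hP] := @linear_of_graph R M (quotm b)
    (fun x z => exists2 r : R^o, z = quotm_pi b r & (s : R) *: x - (r : R) *: m \in L).
- move=> k x _ x' _ [r -> rL] [r' -> rL']; exists (k *: r + r'); first by rewrite linearP.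
  rewrite scalerDr [(_ + _) *: m]scalerDl opprD addrACA rpredD //.
  rewrite (_ : (k *: r) *: m = k *: ((r : R) *: m)); last by rewrite scalerA.
  by rewrite scalerA mulrC -scalerA -scalerBr rpredZ.
- by have [r rL] := sM x; exists (quotm_pi b r), r.
- move=> [r -> rL]; apply/quotm_pi0/mL.
  by move: rL; rewrite scaler0 sub0r rpredN.
have Vb : V (quotm b).
  apply: (V_ext (N' := imm h)).
    have [|k kP] := @factor_inj _ _ _ _ (val : subm (imm h) -> quotm b) h val_inj.
      by move=> y; have yh : h y \in imm h by [apply/immP; exists y]; exists (in_subm yh).
    apply: (V_quot (g := k)) VM => // z; have /immP[y yz] := valP z.
    by exists y; apply: val_inj; rewrite kP.
  apply: (good s) => //.
    move=> r rb; apply/ann_quotm => z; have [t <-] := quotm_pi_surj z.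
    have -> : (r : R) *: quotm_pi b t = 0; last exact: rpred0.
    rewrite -linearZ; apply/quotm_pi0.
    by rewrite /GRing.scale /= mulrC; exact: (rpredZ t rb).
  apply/ann_quotm => z; have [t <-] := quotm_pi_surj z.
  apply/immP; exists ((t : R) *: m); apply/hP; exists ((s : R) *: t); first by rewrite linearZ.
  by rewrite scalerA subrr rpred0.
move=> N bN; have [g gs] := dsum_cyclic_cover bN.
apply: (V_quot (g := g)) (V_dsum _ Vb) => // r /Mb rb; apply/annP => z.
apply: dsumP => n /=; have [t <-] := quotm_pi_surj (z n).
rewrite -linearZ; apply/quotm_pi0.
by rewrite /GRing.scale /= mulrC; exact: (rpredZ t rb).
Qed.
End TorsionClass.

Section Comparison.
Variables (a : ideal R).
Hypothesis noethR : noetherian R.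

(** The kernel of a surjection between modules killed by ann M is again killed by
    ann M, so its H^(i+1)_a vanishes by the induction hypothesis; this is what
    makes H^i_a = 0 pass to quotients. *)
Theorem lc_vanish_ann (M N : lmodType R) i : fin_gen M ->
  (forall j, (i <= j)%N -> lc_vanish a j M) -> ideal_le (ann M) (ann N) ->
  lc_vanish a i N.
Proof.
move=> fgM; have [s sP] := noethR a.
have [d] : exists d, (size s < i + d)%N by exists (size s).+1; lia.
elim: d i N => [|d IH] i N ltd VM MN.
  by apply: (lc_vanish_bound (s := s)) => //; rewrite -[i]addn0.
apply: (torsion_class_ann (M := M)) MN => //.
- exact: VM.
- by move=> L L'; apply: lc_vanish_ext; exact: short_exact_sub.
- by move=> T L VL; apply: lc_vanish_dsum.
- move=> L K g ML gs VL; apply: (lc_vanish_quot (short_exact_ker gs)) => //.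
  apply: IH; first lia.
    by move=> j ij; apply: VM; lia.
  by move=> r /ML/annP rL; apply/ann_subm.
Qed.

Lemma lc_vanish_zero i (N : lmodType R) : zero_module N -> lc_vanish a i N.
Proof.
move=> N0; apply: (@lc_vanish_iso _ _ _ (dsum (fun v : void => R^o)) N \0).
  by exists (fun=> 0) => x; [apply: dsumP; case|rewrite [RHS]N0].
by apply: lc_vanish_dsum => //; case.
Qed.

(** Filtration of [N] by annihilators: the elements killed by all the products of
    the first [n] factors form a submodule, and the last factor kills the
    quotient. *)
Lemma lc_vanish_prod (M : nat -> lmodType R) n i (N : lmodType R) :
  (forall k, (k < n)%N -> fin_gen (M k)) ->
  (forall k j, (k < n)%N -> (i <= j)%N -> lc_vanish a j (M k)) ->
  (forall r : nat -> R, (forall k, (k < n)%N -> (r k : R^o) \in ann (M k)) ->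
    forall x : N, (\prod_(k < n) r k) *: x = 0) ->
  lc_vanish a i N.
Proof.
elim: n N => [|n IH] N fgM VM MN.
  apply: lc_vanish_zero => x.
  by rewrite -[x]scale1r -(MN (fun=> 1) _ x) ?big_ord0.
have cl : submod_closed [pred x : N | `[< forall r : nat -> R,
    (forall k, (k < n)%N -> (r k : R^o) \in ann (M k)) ->
    (\prod_(k < n) r k) *: x = 0 >]].
  split=> [|k x y /asboolP Hx /asboolP Hy]; apply/asboolP => r rM.
    exact: scaler0.
  by rewrite scalerDr scalerA mulrC -scalerA Hx // Hy // scaler0 addr0.
pose N' := Submodule cl.
apply: (lc_vanish_ext (short_exact_sub N')).
  apply: IH => [k kn|k j kn|r rM x].
  - by apply: fgM; lia.
  - by apply: VM; lia.
  - by apply: val_inj; have /asboolP := valP x; exact.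
apply: (@lc_vanish_ann (M n)) => [|j|]; [exact: fgM|exact: VM|].
move=> t tM; apply/ann_quotm => x; apply/asboolP => r rM.
pose r' k := if k == n then (t : R) else r k.
rewrite scalerA -[RHS](MN r' _ x).
  rewrite big_ord_recr /= /r' eqxx; congr (_ * _ *: _).
  by apply: eq_bigr => k _; rewrite ifN // neq_ltn ltn_ord.
move=> k; rewrite /r' ltnS leq_eqVlt; case: eqVneq => [->|_] //=; exact: rM.
Qed.
End Comparison.
End Annihilator.

(** * Flatness of projective modules *)
Section Tensors.
Variable R : comPzRingType.

Section TensorTheory.
Variables M N V : lmodType R.

(** The quotient map by [S] and the zero map agree on pure tensors. *)
Lemma tensor_ind (S : submodule (tensor M N)) :
  (forall x y, tens x y \in S) -> forall u, u \in S.
Proof.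
move=> HS u; apply/quotm_pi0.
by apply: (@tensor_ext _ _ _ _ (quotm_pi S) \0) => x y; apply/quotm_pi0.
Qed.

Lemma tensor_lift (f : M -> N -> V) :
  (forall y, linear (f^~ y)) -> (forall x, linear (f x)) ->
  exists h : {linear tensor M N -> V}, forall x y, h (tens x y) = f x y.
Proof.
move=> fl fr; pose F := free_lift (R := R) (fun p : M * N => f p.1 p.2).
have [|h hP] := @factor_surj _ _ _ _ (quotm_pi (span (@bilinear_relations R M N)))
    F (@quotm_pi_surj _ _ _).
  move=> p /quotm_pi0 pN; apply/kermP; apply: span_sub pN => r rel; apply/kermP.
  have fD y := linearD (linear_of (fl y)); have fZ y := linearZZ (linear_of (fl y)).
  have gD x := linearD (linear_of (fr x)); have gZ x := linearZZ (linear_of (fr x)).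
  case: rel => [[[]|]|] [u [v [w ->]]].
  - by rewrite !linearB /= !free_lift_delta /= [f _ _]fD /= -addrA -opprD; exact: subrr.
  - by rewrite !linearB /= !free_lift_delta /= [f _ _]gD /= -addrA -opprD; exact: subrr.
  - by rewrite linearB linearZ /= !free_lift_delta /= [f _ _]fZ; exact: subrr.
  - by rewrite linearB linearZ /= !free_lift_delta /= [f _ _]gZ; exact: subrr.
by exists h => x y; rewrite hP /= free_lift_delta.
Qed.

Fact tens_linear_l (y : N) : linear (fun x => @tens R M N x y).
Proof. by move=> a u v; rewrite tensDl tensZl. Qed.
End TensorTheory.

Lemma free_lift_seq (T : choiceType) (V : lmodType R) (phi : T -> V)
    (f : free R T) (s : seq T) : uniq s -> (forall t, f t <> 0 -> t \in s) ->
  free_lift phi f = \sum_(t <- s) (f t : R) *: phi t.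
Proof.
move=> us fs; rewrite (@free_lift_widen _ _ _ _ _ [set` s]).
- exact/esym/fsbig_seq.
- exact: finite_seq.
- by move=> t /fs.
Qed.

(** A section [s] of the free cover of [P] gives coordinates [c p] on P (x) B with
    values in [B], and every u is the finite sum of the p (x) c p u.  If the image
    of u in P (x) C vanishes, each coordinate is killed by [g] and lifts
    along [f]. *)
Lemma projective_flat (P A B C : lmodType R) (f : {linear A -> B})
    (g : {linear B -> C}) (u : tensor P B) :
  projective_module P -> (forall y, g y = 0 -> exists x, f x = y) ->
  tensor_map idfun g u = 0 -> exists w : tensor P A, tensor_map idfun f w = u.
Proof.
move=> projP fg gu.
have [|s sP] := projP (free R P) P (free_lift (fun x : P => x)) idfun.
  by move=> x; exists (delta R x); rewrite /= free_lift_delta.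
have coord (V : lmodType R) p :
    {h : {linear tensor P V -> V} | forall x y, h (tens x y) = (s x p : R) *: y}.
  apply: cid; apply: tensor_lift => [y a x x'|x a y y'].
    by rewrite linearP scalerDl -scalerA.
  by rewrite scalerDr !scalerA mulrC.
pose c V p := sval (coord V p).
have cE V p x y : c V p (tens x y) = (s x p : R) *: y by rewrite /c (svalP (coord V p)).
have /choice[a aP] : forall p, exists x, f x = c B p u.
  move=> p; apply: fg; rewrite -[RHS](linear0 (c C p)) -gu.
  apply: (@tensor_ext _ _ _ _ (g \o c B p) (c C p \o tensor_map idfun g)) => x y /=.
  by rewrite tensor_map_tens !cE linearZ.
(* The expansion is required on every larger finite set of indices, which makes
   the condition stable under sums. *)
have cl : submod_closed [pred v : tensor P B | `[< exists T0 : seq P,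
    forall T, uniq T -> {subset T0 <= T} -> v = \sum_(p <- T) tens p (c B p v) >]].
  split=> [|k v v' /asboolP[S SP] /asboolP[S' SP']]; apply/asboolP.
    exists [::] => T _ _; rewrite big1 // => p _.
    by rewrite linear0 -(scale0r 0) tensZr scale0r.
  exists (S ++ S') => T uT ST; rewrite [in LHS](SP T) // => [|p pS]; last first.
    by apply: ST; rewrite mem_cat pS.
  rewrite [in LHS](SP' T) // => [|p pS]; last by apply: ST; rewrite mem_cat pS orbT.
  rewrite scaler_sumr -big_split; apply: eq_bigr => p _.
  by rewrite linearP tensDr tensZr.
have : u \in Submodule cl.
  apply: tensor_ind => x y; apply/asboolP.
  have /finite_seqP[T0 T0E] := dsum_finite (s x).
  exists T0 => T uT sub.
  have {1}-> : x = \sum_(p <- T) (s x p : R) *: p.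
    rewrite -free_lift_seq //; first exact/esym/sP.
    move=> p xp; apply: sub; have : [set p | s x p <> 0] p by [].
    by rewrite T0E.
  rewrite -[LHS]/(linear_of (@tens_linear_l P B y) _) linear_sum.
  apply: eq_bigr => p _; rewrite cE.
  exact: etrans (tensZl _ _ _) (esym (tensZr _ _ _)).
move=> /asboolP[T0 /(_ (undup T0) (undup_uniq _))uE].
exists (\sum_(p <- undup T0) tens p (a p)).
rewrite linear_sum [RHS]uE => [|p]; last by rewrite mem_undup.
by apply: eq_bigr => p _; rewrite /= tensor_map_tens aP.
Qed.
End Tensors.

(** Homotopies and elements of tensor products are modified at one index through
    this lemma, so that the casts between equal degrees stay inside of it. *)
Lemma update2 (T : int -> int -> Type) (F : forall i j, T i j) i0 j0 (v : T i0 j0) :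
  exists F' : forall i j, T i j, F' i0 j0 = v /\
    forall i j, (i != i0) || (j != j0) -> F' i j = F i j.
Proof.
exists (fun i j => match i0 =P i, j0 =P j with
  | ReflectT e, ReflectT e' => ecast i (T i j) e (ecast j (T i0 j) e' v)
  | _, _ => F i j
  end); split.
  case: eqP => // e; case: eqP => // e'.
  by rewrite (eq_axiomK e) (eq_axiomK e').
move=> i j ij; case: eqP => // e; case: eqP => // e'; exfalso.
by move: ij; rewrite -e -e' !eqxx.
Qed.

(** * Annihilators of homology and null-homotopies *)
Section Homotopy.
Variables (R : comPzRingType) (P : complex R) (l0 : int).
Hypotheses (projP : forall l, projective_module (P l))
  (P0 : forall l, l < l0 -> zero_module (P l)).

Fact scaling_linear (M : lmodType R) (r : R) : linear (fun x : M => r *: x).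
Proof. by move=> a x y; rewrite scalerDr !scalerA mulrC. Qed.
Definition scaling (M : lmodType R) r := linear_of (@scaling_linear M r).

(** The homotopy is built degree by degree.  In degree h + 1 the defect
    rho x - s d x of the homotopy reached so far takes values in cycles; its
    multiple by r_n takes values in boundaries, so it lifts along d because
    P (h + 1) is projective.  The components below are multiplied by r_n. *)
Lemma annihilator_homotopy (r : nat -> R) n :
  (forall k, (k < n)%N -> (r k : R^o) \in ann (homology P (l0 + k%:Z))) ->
  exists s : forall i j, {linear P i -> P j}, forall h, h + 1 < l0 + n%:Z ->
    forall x : P (h + 1), diff P (h + 1 + 1) (h + 1) (s (h + 1) (h + 1 + 1) x) +
      s h (h + 1) (diff P (h + 1) h x) = (\prod_(k < n) r k) *: x.
Proof.
elim: n => [|n IH] rP.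
  exists (fun i j => \0) => h hl x; rewrite [x]P0 ?scaler0; last by rewrite addr0 in hl.
  by rewrite /= linear0 addr0.
have [|s sP] := IH; first by move=> k kn; apply: rP; lia.
have [h hE] : exists h, l0 + n%:Z = h + 1 by exists (l0 + n%:Z - 1); rewrite subrK.
pose rho := \prod_(k < n) r k.
pose q : {linear P (h + 1) -> P (h + 1)} := scaling _ (r n) \o
  (scaling _ rho \- (s h (h + 1) \o diff P (h + 1) h)).
have t_bound x : exists y, diff P (h + 1 + 1) (h + 1) y = q x.
  have cyc : rho *: x - s h (h + 1) (diff P (h + 1) h x) \in cycles P (h + 1).
    apply/cyclesP => j; have [jh|jh] := eqVneq j h; last first.
      by apply: diff_shape; apply: contra jh => /eqP/addIr ->.
    subst j; rewrite linearB linearZ /=; apply/eqP; rewrite subr_eq0; apply/eqP.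
    have hs : h = h - 1 + 1 by rewrite subrK.
    have := sP (h - 1); rewrite -hs => /(_ _ (diff P (h + 1) h x)) <-.
      by rewrite diff_diff linear0 addr0.
    by rewrite hE ltrDl.
  have /annP := rP n (ltnSn n); rewrite hE => /(_ (quotm_pi _ (in_subm cyc))).
  by rewrite -linearZ => /quotm_pi0/asboolP[y yE]; exists y.
have [|g gP] := @factor_inj _ _ _ _ (val : subm (imm (diff P (h + 1 + 1) (h + 1))) -> P (h + 1))
    (diff P (h + 1 + 1) (h + 1)) val_inj.
  move=> y; have yi : diff P (h + 1 + 1) (h + 1) y \in imm (diff P (h + 1 + 1) (h + 1)).
    by apply/immP; exists y.
  by exists (in_subm yi).
have [|f fP] := @factor_inj _ _ _ _ (val : subm (imm (diff P (h + 1 + 1) (h + 1))) -> P (h + 1))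
    q val_inj.
  by move=> x; have /immP xi := t_bound x; exists (in_subm xi).
have [|t tP] := @projP (h + 1) _ _ g f.
  move=> z; have /immP[y yz] := valP z; exists y.
  by apply: val_inj; rewrite gP.
have [s' [s'h s'E]] := @update2 (fun i j => {linear P i -> P j})
  (fun i j => scaling _ (r n) \o s i j) (h + 1) (h + 1 + 1) t.
exists s' => i il x; rewrite big_ord_recr /=.
have [ih|ih] := eqVneq i h.
  subst i; rewrite s'h s'E /=; last by rewrite neq_lt ltrDl.
  have -> : diff P (h + 1 + 1) (h + 1) (t x) =
      r n *: (rho *: x - s h (h + 1) (diff P (h + 1) h x)).
    rewrite -[RHS]/(q x).
    by rewrite -gP -fP; congr (val _); exact: tP.
  rewrite -[X in _ + X = _]/(r n *: s h (h + 1) (diff P (h + 1) h x)).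
  by rewrite scalerBr subrK scalerA mulrC.
rewrite !s'E /=; first last.
- by apply/orP; left; apply: contra ih => /eqP/addIr ->.
- apply/orP; left; lia.
rewrite -[X in _ + X = _]/(r n *: s i (i + 1) (diff P (i + 1) i x)) linearZ /=.
rewrite -scalerDr sP; first by rewrite scalerA mulrC.
lia.
Qed.
End Homotopy.

(** * Homology of the tensor product *)
Lemma tensor_map0 (R : comPzRingType) (M N M' N' : lmodType R)
  (f : {linear M -> M'}) (g : {linear N -> N'}) : tensor_map f g 0 = 0.
Proof. exact: linear0. Qed.

Lemma tensor_mapZ (R : comPzRingType) (M N M' N' : lmodType R)
    (f : {linear M -> M'}) (g : {linear N -> N'}) a u :
  tensor_map f g (a *: u) = a *: tensor_map f g u.
Proof. exact: linearZ. Qed.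

Lemma tensor_mapD (R : comPzRingType) (M N M' N' : lmodType R)
    (f : {linear M -> M'}) (g : {linear N -> N'}) u v :
  tensor_map f g (u + v) = tensor_map f g u + tensor_map f g v.
Proof. exact: linearD. Qed.

Section TensorHomology.
Variables (R : comPzRingType) (P Y : complex R).

Definition bideg i j n (e : i + j = n) : bidegree n :=
  exist (fun p : int * int => p.1 + p.2 == n) (i, j) (introT eqP e).

(** The component of bidegree (i, j), extended by 0 when i + j differs from [n]: as
    a function of two free integers it spares the membership proof carried by
    [bidegree n]. *)
Definition component n (f : tensor_obj P Y n) i j : tensor (P i) (Y j) :=
  if i + j =P n is ReflectT e then f (bideg e) else 0.

Lemma component_bidegree n (f : tensor_obj P Y n) (q : bidegree n) :
  component f (val q).1 (val q).2 = f q.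
Proof.
case: q => [[i j] ij]; rewrite /component /=; case: eqP => [e|ne].
  by rewrite /bideg (bool_irrelevance (introT eqP e) ij).
by exfalso; apply/ne/eqP.
Qed.

Lemma component_ext n (f g : tensor_obj P Y n) :
  (forall i j, i + j = n -> component f i j = component g i j) -> f = g.
Proof.
by move=> fg; apply: dsumP => q; rewrite -!component_bidegree; exact/fg/eqP/(valP q).
Qed.

Fact component_linear n i j : linear (fun f : tensor_obj P Y n => component f i j).
Proof.
move=> a f g; rewrite /component; case: eqP => [//|_].
by rewrite scaler0 addr0.
Qed.

Lemma component0 n i j : component (0 : tensor_obj P Y n) i j = 0.
Proof. exact: linear0 (linear_of (@component_linear n i j)). Qed.

Lemma component_mk n (F : forall i j, tensor (P i) (Y j)) (A : set (bidegree n)) :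
  finite_set A -> (forall q : bidegree n, F (val q).1 (val q).2 <> 0 -> A q) ->
  exists f : tensor_obj P Y n, forall i j, i + j = n -> component f i j = F i j.
Proof.
move=> finA FA; exists (Dsum (sub_finite_set FA finA)) => i j ij.
by rewrite /component; case: eqP.
Qed.

Lemma component_diff m n (f : tensor_obj P Y n) i j : n = m + 1 -> i + j = m ->
  component (diff (tensor_complex P Y) n m f) i j =
  tensor_map (diff P (i + 1) i) idfun (component f (i + 1) j) +
  (-1) ^+ `|i|%N *: tensor_map idfun (diff Y (j + 1) j) (component f i (j + 1)).
Proof.
move=> nm ij; rewrite /= /tensor_diff; case: eqP => // e.
rewrite {1}/component; case: eqP => // ij'; rewrite /= /tensor_diff_comp /=.
by congr (_ + _ *: _); congr (tensor_map _ _ _); rewrite -component_bidegree.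
Qed.

Lemma component_single n i0 j0 (v : tensor (P i0) (Y j0)) : i0 + j0 = n ->
  exists f : tensor_obj P Y n, component f i0 j0 = v /\
    forall i j, i + j = n -> i != i0 -> component f i j = 0.
Proof.
move=> ij0; have [F [F0 FE]] := @update2 (fun i j => tensor (P i) (Y j))
  (fun _ _ => 0) i0 j0 v.
have [||f fE] := @component_mk n F [set bideg ij0].
- exact: finite_set1.
- move=> [[i j] ij] /= Fij; apply: val_inj => /=.
  apply: contrapT => ne; apply: Fij; apply: FE; rewrite -negb_and.
  by apply/negP => /andP[/eqP e /eqP e']; apply: ne; rewrite e e'.
by exists f; split=> [|i j ij ii0]; rewrite fE // FE // ii0.
Qed.

Lemma component_bounded n (f : tensor_obj P Y n) c :
  exists k : nat, forall i j, i + j = n -> c + k%:Z <= i -> component f i j = 0.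
Proof.
have /finite_seqP[s sE] := dsum_finite f.
have [B BP] : exists B, forall q, q \in s -> (`|(val q).1|%N <= B)%N.
  exists (\max_(q <- s) `|(val q).1|)%N => q qs.
  exact: (@leq_bigmax_seq _ s xpredT (fun q : bidegree n => `|(val q).1|%N)).
exists (B.+1 + `|c|)%N => i j ij ci.
apply: contrapT => nz; move: nz; rewrite /component; case: eqP => // e nz.
have /BP : bideg e \in s by have : [set` s] (bideg e) by rewrite -sE.
by rewrite /=; lia.
Qed.

Section Vanishing.
Variables (t : int) (projP : forall l, projective_module (P l)).
Hypothesis Yt : forall l, l < t -> zero_module (homology Y l).

(** The components are removed one at a time, from the top degree in [P] downwards.
    If i0 is the largest first degree where z is nonzero, the component there is a
    cycle of P i0 (x) Y; it has degree less than t in Y, so it is a boundary by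
    flatness, and subtracting the boundary only changes lower first degrees. *)
Lemma cycle_truncate d c (k : nat) (z : tensor_obj P Y d) : d - t < c ->
  (forall j, diff (tensor_complex P Y) d j z = 0) ->
  (forall i j, i + j = d -> c + k%:Z <= i -> component z i j = 0) ->
  exists w : tensor_obj P Y (d + 1), forall i j, i + j = d -> c <= i ->
    component (z - diff (tensor_complex P Y) (d + 1) d w) i j = 0.
Proof.
move=> dtc; elim: k z => [|k IH] z dz zc.
  by exists 0 => i j ij ci; rewrite linear0 subr0 zc // addr0.
pose i0 := c + k%:Z.
have [j ijd] : exists j, i0 + (j + 1) = d by exists (d - i0 - 1); lia.
have z0 : component z (i0 + 1) j = 0 by apply: zc; rewrite /i0; lia.
have dY : tensor_map idfun (diff Y (j + 1) j) (component z i0 (j + 1)) = 0.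
  have ij1 : i0 + j = d - 1 by lia.
  have := @component_diff (d - 1) d z i0 j (esym (subrK _ _)) ij1.
  rewrite dz z0 component0 tensor_map0 add0r.
  by move=> /(congr1 (fun u => (-1) ^+ `|i0|%N *: u)); rewrite scaler0 signrZK.
have [|v vE] := projective_flat (f := diff Y (j + 1 + 1) (j + 1)) (@projP i0) _ dY.
  move=> y dy; have jt : j + 1 < t by rewrite /i0 in ijd; lia.
  have [|l [x xy]] := iffLR (homology0P _ _) (Yt jt) y.
    move=> l; have [->//|lj] := eqVneq l j.
    by apply: diff_shape; apply: contra lj => /eqP/addIr ->.
  have [lj|lj] := eqVneq l (j + 1 + 1); first by subst l; exists x.
  by exists 0; rewrite linear0 -xy diff_shape.
have ij0 : i0 + (j + 1 + 1) = d + 1 by lia.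
have [w [w0 wE]] := component_single ((-1) ^+ `|i0|%N *: v) ij0.
have componentB i l : component (z - diff (tensor_complex P Y) (d + 1) d w) i l =
    component z i l - component (diff (tensor_complex P Y) (d + 1) d w) i l.
  exact: (linearB (linear_of (@component_linear _ i l))).
have [|i l il ci|w' w'E] := IH (z - diff (tensor_complex P Y) (d + 1) d w).
- by move=> l; rewrite linearB dz diff_diff subr0.
- rewrite componentB component_diff // (wE (i + 1)); [|lia|lia].
  rewrite tensor_map0 add0r; have [ii0|ii0] := eqVneq i i0; last first.
    rewrite (wE i) //; last lia.
    rewrite tensor_map0 scaler0 subr0 zc //; lia.
  have lj : l = j + 1 by lia.
  by subst i l; rewrite w0 tensor_mapZ signrZK vE subrr.
exists (w + w') => i l il ci; rewrite -(w'E i l il ci).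
by congr (component _ i l); rewrite linearD opprD addrA.
Qed.

(** The differential of s (x) 1 applied to z is (ds + sd) (x) 1 applied to z: the
    terms with 1 (x) d cancel because z is a cycle. *)
Lemma truncated_cycle_killed d c (r : R) (s : forall i j, {linear P i -> P j})
    (z : tensor_obj P Y d) :
  (forall h, h + 1 < c -> forall x : P (h + 1),
    diff P (h + 1 + 1) (h + 1) (s (h + 1) (h + 1 + 1) x) +
    s h (h + 1) (diff P (h + 1) h x) = r *: x) ->
  (forall j, diff (tensor_complex P Y) d j z = 0) ->
  (forall i j, i + j = d -> c <= i -> component z i j = 0) ->
  exists w, diff (tensor_complex P Y) (d + 1) d w = r *: z.
Proof.
move=> sP dz zc.
pose F i j : tensor (P i) (Y j) := tensor_map (s (i - 1) i) idfun (component z (i - 1) j).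
have FS h j : F (h + 1) j = tensor_map (s h (h + 1)) idfun (component z h j).
  have gen k : k = h -> tensor_map (s k (h + 1)) idfun (component z k j) =
      tensor_map (s h (h + 1)) idfun (component z h j) by move=> ->.
  exact: gen (addrK _ _).
have low (q : bidegree (d + 1)) : (val q).1 - 1 + (val q).2 = d.
  by have := eqP (valP q); rewrite /=; lia.
have [||w wE] := @component_mk (d + 1) F ((fun q => bideg (low q)) @^-1` [set q | z q <> 0]).
- apply: finite_preimage; last exact: dsum_finite.
  move=> [[i j] ij] [[i' j'] ij'] _ _ /(congr1 val)[/addIr /= ii jj].
  by apply: val_inj; rewrite /= ii jj.
- move=> q Fq zq; apply: Fq; rewrite /F.
  have -> : component z ((val q).1 - 1) (val q).2 = z (bideg (low q)) by rewrite -component_bidegree.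
  by rewrite [z _]zq tensor_map0.
exists w; apply: component_ext => i j.
have [h ->] : exists h, i = h + 1 by exists (i - 1); rewrite subrK.
move=> ij; rewrite component_diff // !wE; [|lia|lia].
rewrite !FS !tensor_map_comp.
have hj : h + j = d - 1 by lia.
have := @component_diff (d - 1) d z h j (esym (subrK _ _)) hj.
rewrite dz component0 => /(congr1 (tensor_map (s h (h + 1)) (idfun : {linear Y j -> Y j}))).
rewrite tensor_map0 tensor_mapD tensor_mapZ !tensor_map_comp => /esym/eqP.
rewrite addr_eq0 sign_absz_succ scaleNr => /eqP e.
set b := tensor_map (idfun \o _) _ _.
have -> : b = tensor_map (s h (h + 1) \o idfun) (idfun \o diff Y (j + 1) j) (component z h (j + 1)).
  exact: tensor_map_eq.
rewrite -e.
have -> : component (r *: z) (h + 1) j = r *: component z (h + 1) j.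
  exact: (linearZZ (linear_of (@component_linear d (h + 1) j))).
have [hc|hc] := ltP (h + 1) c; last by rewrite zc // !tensor_map0 scaler0 addr0.
apply: (@tensor_ext _ _ _ _
  (tensor_map (diff P (h + 1 + 1) (h + 1) \o s (h + 1) (h + 1 + 1)) (idfun \o idfun) \+
   tensor_map (s h (h + 1) \o diff P (h + 1) h) (idfun \o idfun)) (scaling _ r)) => x y.
rewrite /= !tensor_map_tens -tensDl sP //; exact: tensZl.
Qed.

(** A cycle is first moved into degrees less than l0 + n of [P], where the
    homotopy is available; the hypothesis on [d] says that the components removed
    have degree less than [t] in [Y]. *)
Theorem tensor_homology_killed l0 n d (r : nat -> R) :
  (forall l, l < l0 -> zero_module (P l)) -> d < l0 + n%:Z + t ->
  (forall k, (k < n)%N -> (r k : R^o) \in ann (homology P (l0 + k%:Z))) ->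
  forall h : homology (tensor_complex P Y) d, (\prod_(k < n) r k) *: h = 0.
Proof.
move=> P0 ld rP h; have [s sP] := annihilator_homotopy projP P0 rP.
have [z <-] := quotm_pi_surj h.
have dz := iffLR (cyclesP _) (valP z).
have [k zk] := component_bounded (val z) (l0 + n%:Z).
have [|w wz] := @cycle_truncate d (l0 + n%:Z) k (val z) _ dz zk; first lia.
have [|v vE] := truncated_cycle_killed sP _ wz.
  by move=> j; rewrite linearB dz diff_diff subr0.
rewrite -linearZ; apply/quotm_pi0/asboolP.
exists (v + (\prod_(k < n) r k) *: w); rewrite linearD linearZ vE.
by rewrite -scalerDr subrK.
Qed.
End Vanishing.
End TensorHomology.

(** * Suprema and the inequality *)
Section Assembly.
Variables (R : comPzRingType) (a : ideal R).

Lemma local_cohomology_vanish i (M : lmodType R) :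
  local_cohomology_neq0 a i M <-> exists2 n : nat, i = n%:Z & ~ lc_vanish a n M.
Proof.
split=> [[I [e [resI nz]]]|[n -> nV]].
  case: i nz => n nz; last first.
    exfalso; apply: nz => h; have [z <-] := quotm_pi_surj h.
    have [_ I0 _ _ _] := resI.
    rewrite (_ : z = 0) ?linear0 //; do 2 apply: val_inj => /=.
    by apply: I0; rewrite NegzE opprK.
  by exists n => //; rewrite (lc_vanish_resolution a resI).
have [I [e resI]] := injective_resolution_exists M.
by exists I, e; split=> //; rewrite -(lc_vanish_resolution a resI).
Qed.

Lemma ann_surj (M N : lmodType R) (f : {linear M -> N}) :
  (forall z, exists y, f y = z) -> ideal_le (ann M) (ann N).
Proof.
move=> fs r /annP rM; apply/annP => z; have [y <-] := fs z.
by rewrite -linearZ rM linear0.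
Qed.

Lemma ann_inj (M N : lmodType R) (f : {linear M -> N}) :
  injective f -> ideal_le (ann N) (ann M).
Proof.
move=> fi r /annP rN; apply/annP => z; apply: fi.
by rewrite linearZ /= rN linear0.
Qed.

Lemma bij_surj (M N : Type) (f : M -> N) : bijective f -> forall z, exists y, f y = z.
Proof. by move=> [g fg gf] z; exists (g z). Qed.

Lemma lc_vanish_derived_tensor (X Y W : complex R) (t d : int) (i : nat) :
  noetherian R -> (forall l, fin_gen (homology X l)) -> is_derived_tensor X Y W ->
  (forall l, l < t -> zero_module (homology Y l)) ->
  (forall l j, l <= d - t -> (i <= j)%N -> lc_vanish a j (homology X l)) ->
  lc_vanish a i (homology W d).
Proof.
move=> noethR fgX [P [f [[[l0 P0] projP qf] [Z [u [v [qu qv]]]]]]] Yt XV.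
(* [n] counts the degrees from l0 to d - t. *)
have [n [ln nl]] : exists n : nat, d < l0 + n%:Z + t /\
    forall k, (k < n)%N -> l0 + k%:Z <= d - t.
  have [dl|dl] := ltP (d - t) l0; first by exists 0%N; split=> //; lia.
  by exists `|(d - t - l0)%R|.+1%N; split=> [|k kn]; lia.
apply: (@lc_vanish_prod _ _ noethR (fun k => homology X (l0 + k%:Z)) n).
- by move=> k _; exact: fgX.
- by move=> k j kn ij; apply: XV => //; exact: nl.
move=> r rX.
have killed := tensor_homology_killed projP Yt P0 ln
  (fun k kn => ann_inj (bij_inj (qf (l0 + k%:Z))) (rX k kn)).
suff /annP : ((\prod_(k < n) r k : R) : R^o) \in ann (homology W d) by [].
apply: (ann_surj (bij_surj (qv d))); apply: (ann_inj (bij_inj (qu d))).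
exact/annP/killed.
Qed.

(** The supremum of [A] is attained when [A] contains an integer and is bounded
    above by an integer, and is infinite otherwise. *)
Lemma le_supremum (A : set (\bar int)) x : A x -> (x <= supremum -oo A)%E.
Proof.
move=> Ax; apply: ge_supremum_Nmem Ax.
have [[n An]|unb] := pselect (exists n : int, ubound A n%:E); last first.
  exists +oo%E; split=> [y _|[u||] uA]; rewrite ?leey //.
    by exfalso; apply: unb; exists u.
  by exfalso; apply: unb; exists 0 => y /uA; rewrite leeNy_eq => /eqP ->.
have [exk|nA] := pselect (exists k : nat, `[< A (n - k%:Z)%:E >]); last first.
  exists -oo%E; split=> [[y||] Ay //|u _]; last exact: leNye.
    exfalso; apply: nA; exists `|n - y|%N; apply/asboolP.
    by have := An _ Ay; rewrite lee_fin => yn; rewrite (_ : n - _ = y) //; lia.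
  by have := An _ Ay.
case: (ex_minnP exk) => m /asboolP Am mmin.
exists (n - m%:Z)%:E; split=> [[y||] Ay|u uA]; last exact: uA.
- have := An _ Ay; rewrite !lee_fin => yn.
  have /mmin : `[< A (n - `|n - y|%N%:Z)%:E >].
    by apply/asboolP; rewrite (_ : n - _ = y) //; lia.
  lia.
- by have := An _ Ay.
- exact: leNye.
Qed.

Lemma supremum_le (A : set (\bar int)) y :
  (forall x, A x -> (x <= y)%E) -> (supremum -oo A <= y)%E.
Proof.
move=> Ay; rewrite /supremum; case: ifP => _; first exact: leNye.
by case: xgetP => [x _ [_ /(_ y Ay)]//|_]; exact: leNye.
Qed.

Lemma inf_complex_min (Y : complex R) : Df_plus Y ->
  (inf_complex Y = +oo%E /\ forall l, zero_module (homology Y l)) \/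
  exists2 t : int, inf_complex Y = t%:E &
    forall l, l < t -> zero_module (homology Y l).
Proof.
move=> [[n Yn] _]; have [Y0|nz] := pselect (forall l, zero_module (homology Y l)).
  left; split=> //; rewrite /inf_complex /infimum ifT //.
  by apply/eqP/seteqP; split=> // x [l nYl _]; case: (nYl (Y0 l)).
have exk : exists k : nat, `[< ~ zero_module (homology Y (n + k%:Z)) >].
  apply: contrapT => nk; apply: nz => l; have [/Yn//|nl] := ltP l n.
  apply: contrapT => nYl; apply: nk; exists `|l - n|%N; apply/asboolP.
  by rewrite (_ : n + _ = l) //; lia.
case: (ex_minnP exk) => m /asboolP Ym mmin.
have Yt l : l < n + m%:Z -> zero_module (homology Y l).
  move=> lt; have [/Yn//|nl] := ltP l n.
  apply: contrapT => nYl; have /mmin : `[< ~ zero_module (homology Y (n + `|l - n|%N%:Z)) >].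
    by apply/asboolP; rewrite (_ : n + _ = l) //; lia.
  lia.
right; exists (n + m%:Z) => //.
have inf : infimums [set l%:E | l in [set l : int | ~ zero_module (homology Y l)]]
    (n + m%:Z)%:E.
  split=> [_ [l nYl <-]|u]; last by apply; exists (n + m%:Z).
  by rewrite lee_fin leNgt; apply/negP => /Yt.
rewrite /inf_complex /infimum ifF; last first.
  by apply/eqP => e; have [+ _] := inf; move=> _; have : set0 (n + m%:Z)%:E
    by rewrite -e; exists (n + m%:Z).
by apply: xget_subset1 => //; exact: is_subset1_infimums.
Qed.
End Assembly.

Theorem corollary2p10 (R : comPzRingType) (a : ideal R) (X Y W : complex R) :
  noetherian R -> finite_krull_dim R ->
  Df_plus X -> Df_plus Y -> is_derived_tensor X Y W ->
  (cd_complex a W <= cd_complex a X - inf_complex Y)%E.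
Proof.
move=> noethR _ [[l0 X0] fgX] DY tW.
apply: supremum_le => _ [d _ <-].
have vanish i (M : lmodType R) : ~ local_cohomology_neq0 a i%:Z M -> lc_vanish a i M.
  by move=> nM; apply: contrapT => nV; apply: nM; apply/local_cohomology_vanish; exists i.
have cdX l j : (cd_complex a X + l%:E < j%:Z%:E)%E -> lc_vanish a j (homology X l).
  move=> ltj; apply: vanish => nz; move: ltj; rewrite ltNge => /negP; apply.
  have : (cd a (homology X l) - l%:E <= cd_complex a X)%E by apply: le_supremum; exists l.
  have : (j%:Z%:E <= cd a (homology X l))%E by apply: le_supremum; exists j%:Z.
  case: (cd _ _) => [x||]; case: (cd_complex _ _) => [y||] //=.
  by rewrite !lee_fin; lia.
(* If H(Y) = 0, the bound d - l0 + 1 is admissible for t, and H_l(X) = 0 for all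
   l <= d - t. *)
have [[-> Y0]|[t -> Yt]] := inf_complex_min DY.
  rewrite (_ : cd a (homology W d) = -oo%E) ?leNye //.
  rewrite /cd (_ : [set i%:E | i in _] = set0) ?supremum0 //.
  apply/seteqP; split=> // x [i /local_cohomology_vanish[n -> nV] _]; apply: nV.
  apply: (@lc_vanish_derived_tensor _ _ X Y W (d - l0 + 1) d) => // l j ld _.
  apply: lc_vanish_zero => //; apply: X0; lia.
have : (cd a (homology W d) <= cd_complex a X - t%:E + d%:E)%E.
  apply: supremum_le => _ [i /local_cohomology_vanish[n -> nV] <-].
  rewrite leNgt; apply/negP => lt; apply: nV.
  apply: (lc_vanish_derived_tensor noethR fgX tW Yt) => l j ld nj; apply: cdX.
  case: (cd_complex _ _) lt => [y||] //=; rewrite !lte_fin; lia.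
case: (cd _ _) => [x||]; case: (cd_complex _ _) => [y||] //=.
- by rewrite !lee_fin; lia.
- by move=> _; rewrite leey.
- by move=> _; rewrite leNye.
Qed.
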